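(* Assume that $\lambda_1<0$ (i.e. $0$ is an unstable steady state). Let $u$ be the solution of the patch problem (P) with a nonnegative continuous and compactly supported initial datum $u_0\not\equiv 0$. Then $$\inf_{x\in\mathbb{R}}\Big(\liminf_{t\to+\infty}u(t,x)\Big)>0.$$
   Context: Setting. Let $l_1,l_2,d_1,d_2,\sigma>0$ and $l=l_1+l_2$. The real line is divided into patches of type 1 (KPP), $(nl-l_1,nl)$, and of type 2 (bistable), $(nl,nl+l_2)$, $n\in\mathbb{Z}$. Set $S_1=l\mathbb{Z}$, $S_2=l\mathbb{Z}+l_2$, $S=S_1\cup S_2$. Let $d(x)=d_1$, $f(x,s)=f_1(s)$ for $x\in(nl-l_1,nl)$ and $d(x)=d_2$, $f(x,s)=f_2(s)$ for $x\in(nl,nl+l_2)$. The functions $f_1,f_2\in C^1(\mathbb{R})$ satisfy, for some $K_1,K_2>0$ and $\theta\in(0,K_2)$: (KPP) $f_1(0)=f_1(K_1)=0$, $0<f_1(s)\le f_1'(0)s$ for $s\in(0,K_1)$, $f_1'(K_1)<0$, $f_1<0$ in $(-\infty,0)\cup(K_1,+\infty)$; (Bistable) $f_2(0)=f_2(\theta)=f_2(K_2)=0$, $f_2'(0)<0$, $f_2'(\theta)>0$, $f_2'(K_2)<0$, $f_2<0$ in $(0,\theta)\cup(K_2,+\infty)$, $f_2>0$ in $(-\infty,0)\cup(\theta,K_2)$. The patch problem (P) is $$\begin{cases}u_t-d(x)u_{xx}=f(x,u), & t>0,\ x\in\mathbb{R}\setminus S,\\ u(t,x^-)=u(t,x^+),\quad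 u_x(t,x^-)=\sigma u_x(t,x^+), & t>0,\ x\in S_1,\\ u(t,x^-)=u(t,x^+),\quad \sigma u_x(t,x^-)=u_x(t,x^+), & t>0,\ x\in S_2.\end{cases}$$ A solution with bounded, nonnegative, continuous initial datum $u_0$ is the (unique) continuous function $u$ on $[0,+\infty)\times\mathbb{R}$, bounded on $[0,T]\times\mathbb{R}$ for all $T>0$, with $u(0,\cdot)=u_0$, which is $C^1$ in $t$ and $C^2$ in $x$ on $(0,+\infty)\times\overline{I}$ for each patch $I$, and satisfies (P) classically. Periodic means $l$-periodic in $x$. Principal eigenvalue. $\lambda_1$ is the unique real number for which there is a (unique) continuous function $\phi:\mathbb{R}\to\mathbb{R}$, with $\phi|_{\overline{I}}\in C^\infty(\overline{I})$ for each patch $I$, such that $-d(x)\phi''(x)-f_s(x,0)\phi(x)=\lambda_1\phi(x)$ for $x\in\mathbb{R}\setminus S$, $\phi'(x^-)=\sigma\phi'(x^+)$ for $x\in S_1$, $\sigma\phi'(x^-)=\phi'(x^+)$ for $x\in S_2$, $\phi$ is periodic, $\phi>0$, $\|\phi\|_{L^\infty(\mathbb{R})}=1$. Here $f_s=\partial f/\partial s$. *)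

(* Defs.v *)
From HB Require Import structures.
From mathcomp Require Export all_boot all_order all_algebra.
From mathcomp Require Export all_classical all_reals all_analysis.
Export numFieldNormedType.Exports.

Set Implicit Arguments.
Unset Strict Implicit.
Unset Printing Implicit Defensive.

Import Order.TTheory GRing.Theory Num.Theory.

Local Open Scope classical_set_scope.
Local Open Scope ring_scope.

Section Functions.
Context (R : realType).
Implicit Types (f g : R -> R).

Definition is_C1 f := (forall s, derivable f s 1) /\ continuous (derive1 f).

Definition KPP f (K : R) :=
  [/\ is_C1 f /\ (f 0 = 0 /\ f K = 0),
      forall s, 0 < s < K -> 0 < f s <= derive1 f 0 * s,
      derive1 f K < 0
    & forall s, s < 0 \/ K < s -> f s < 0].

Definition bistable f (theta K : R) :=
  [/\ is_C1 f /\ [/\ f 0 = 0, f theta = 0 & f K = 0],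
      [/\ derive1 f 0 < 0, 0 < derive1 f theta & derive1 f K < 0],
      forall s, 0 < s < theta \/ K < s -> f s < 0
    & forall s, s < 0 \/ theta < s < K -> 0 < f s].

(* [g'] is the derivative on [A] of the restriction of [g] to [A]; it is
   one-sided at the end points when [A] is a closed interval. *)
Definition derivative_within (A : set R) (g g' : R -> R) :=
  forall x, A x -> (g y - g x) / (y - x) @[y --> within A x^'] --> g' x.

Definition smooth_within (A : set R) g :=
  exists D : nat -> R -> R,
    D 0%N = g /\ forall n, derivative_within A (D n) (D n.+1).

(* C^1 in t and C^2 in x on (0, +oo) x A: the derivatives u_t, u_x, u_xx exist
   there (one-sided in x at the boundary of A) and are jointly continuous. *)
Definition C12_within (A : set R) (u : R -> R -> R) :=
  exists ut ux uxx : R -> R -> R,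
    [/\ forall t x : R, 0 < t -> A x -> is_derive t 1 (u^~ x) (ut t x),
        forall t : R, 0 < t -> derivative_within A (u t) (ux t),
        forall t : R, 0 < t -> derivative_within A (ux t) (uxx t)
      & let cont v := {within [set t : R | 0 < t] `*` A,
                        continuous (fun p : R * R => v p.1 p.2 : R)} in
        [/\ cont u, cont ut, cont ux & cont uxx]].

Definition left_limit g (x : R) : R := lim (g y @[y --> x^'-]).
Definition right_limit g (x : R) : R := lim (g y @[y --> x^'+]).

End Functions.

Section PatchModel.
Context (R : realType).
Context (l1 l2 d1 d2 sigma : R) (f1 f2 : R -> R).

Definition period : R := l1 + l2.

Definition interfaces1 : set R := [set n%:~R * period | n in [set: int]].
Definition interfaces2 : set R := [set n%:~R * period + l2 | n in [set: int]].
Definition interfaces : set R := interfaces1 `|` interfaces2.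

(* ]a, b[ is a patch of type 1, resp. of type 2 *)
Definition patch1 (a b : R) :=
  exists n : int, a = n%:~R * period - l1 /\ b = n%:~R * period.
Definition patch2 (a b : R) :=
  exists n : int, a = n%:~R * period /\ b = n%:~R * period + l2.
Definition is_patch (a b : R) := patch1 a b \/ patch2 a b.

Definition in_patch1 (x : R) := exists a b, patch1 a b /\ a < x < b.

(* The values of the coefficients on [interfaces] are junk, and never used. *)
Definition diffusion (x : R) : R :=
  if `[< in_patch1 x >] then d1 else d2.
Definition reaction (x : R) : R -> R :=
  if `[< in_patch1 x >] then f1 else f2.

(* The one-sided limits below always exist for the functions considered, which
   are C^1 up to the boundary of each patch. *)
Definition flux_conditions (g : R -> R) :=
  (forall x, interfaces1 x ->
     left_limit (derive1 g) x = sigma * right_limit (derive1 g) x) /\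
  (forall x, interfaces2 x ->
     sigma * left_limit (derive1 g) x = right_limit (derive1 g) x).

Definition patch_solution (u0 : R -> R) (u : R -> R -> R) :=
  [/\ {within [set p : R * R | 0 <= p.1], continuous (fun p => u p.1 p.2)},
      forall T : R, 0 < T ->
        exists M : R, forall t x : R, 0 <= t <= T -> `|u t x| <= M,
      forall x, u 0 x = u0 x,
      forall a b, is_patch a b -> C12_within `[a, b] u
    & [/\ forall t x : R, 0 < t -> ~ interfaces x ->
            derive1 (u^~ x) t - diffusion x * derive1n 2 (u t) x
            = reaction x (u t x),
          forall t x : R, 0 < t -> interfaces x ->
            left_limit (u t) x = right_limit (u t) x
        & forall t : R, 0 < t -> flux_conditions (u t)]].

Definition principal_eigenfunction (lambda : R) (phi : R -> R) :=
  [/\ continuous phi /\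
        (forall a b, is_patch a b -> smooth_within `[a, b] phi),
      forall x, ~ interfaces x ->
        - diffusion x * derive1n 2 phi x - derive1 (reaction x) 0 * phi x
          = lambda * phi x,
      flux_conditions phi,
      periodic phi period
    & (forall x, 0 < phi x) /\
      ('N[lebesgue_measure]_+oo[EFin \o phi] = 1)%E].

Definition principal_eigenvalue (lambda : R) :=
  exists phi, principal_eigenfunction lambda phi.

End PatchModel.

(* Main.v *)
Require Import Defs.
From mathcomp Require Import all_boot all_order all_algebra.
From mathcomp Require Import all_classical all_reals all_analysis.
From mathcomp Require Import ring lra.
Import Order.TTheory GRing.Theory Num.Theory.
Import numFieldNormedType.Exports.

Set Implicit Arguments.
Unset Strict Implicit.
Unset Printing Implicit Defensive.

Local Open Scope classical_set_scope.
Local Open Scope ring_scope.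

(** Persistence follows from explicit subsolutions, built from the periodic
    eigenfunction [phi] alone.

    Let [k] be [sigma] on the patches of type 1 and 1 on those of type 2, and let
    the phase [z] be a continuous function with [z' = k / phi^2] on each patch
    ([is_phase], [phase_exists]). A function [phi * X(z)] satisfies the flux
    conditions for every smooth [X], and
    [d (phi X(z))'' + f_s(x,0) phi X(z) + lambda phi X(z) = d k^2 X''(z) / phi^3],
    without a first-order term. So in the unknown [v = u / phi] and the variable
    [z] the interfaces disappear, and the linearised problem reads
    [v_t = a v_zz - lambda v] with a coefficient [a = d k^2 / phi^4] between two
    positive constants [a0] and [a1] ([diffusion_bounds]). For small [v >= 0] the
    nonlinear problem gives [v_t >= a v_zz + b v] with [b = - lambda / 2 > 0]
    ([linear_growth]).

    The maximum principle ([comparison]) is proved by minimising over a compact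
    rectangle; at an interface, the flux conditions force the space derivative
    of the difference to vanish at a minimum, so the second-order test holds there
    as well ([transmitted_min], [touching_from_below]). It first gives [u >= 0]
    ([solution_ge0]).

    Two families of barriers then suffice. The bump
    [eta e^(-kappa t) cos(eps (z - z0))] on one half-period of the cosine is a
    subsolution if [eps^2 a1 <= b + kappa] ([bump_barrier]); with [kappa = 0] it is
    stationary, which is where [lambda < 0] is used. And
    [eta (e^(-mu |z - z0|) - e^(-mu^2 a0 t))] is a subsolution on either side of
    [z0] that starts at or below zero, so a value held at one point spreads from there
    ([spreading]). A narrow decaying bump keeps [u] positive at one point during a
    unit of time; spreading at a high speed makes [u] positive on a wide interval
    at time 1; a wide stationary bump then keeps [v >= eta] at that point for
    ever; and spreading from there at a low speed, for which the limit
    [eta e^(-mu |z - z0|)] is close to [eta], gives [v >= eta / 2] at large times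
    at every point, with the same [eta]. *)

(** * Differentiation on the line *)

Section Differentiation.
Context {R : realType}.
Implicit Types (g h : R -> R) (x : R).

Lemma is_derive1M g h x dg dh : is_derive x 1 g dg -> is_derive x 1 h dh ->
  is_derive x 1 (fun y => g y * h y) (dg * h x + g x * dh).
Proof.
move=> dgx dhx; have := is_deriveM dgx dhx.
by rewrite /GRing.scale /= (mulrC (h x)) addrC; exact.
Qed.

Lemma is_derive1D g h x dg dh : is_derive x 1 g dg -> is_derive x 1 h dh ->
  is_derive x 1 (fun y => g y + h y) (dg + dh).
Proof. by move=> dgx dhx; have := is_deriveD dgx dhx. Qed.

Lemma is_derive1B g h x dg dh : is_derive x 1 g dg -> is_derive x 1 h dh ->
  is_derive x 1 (fun y => g y - h y) (dg - dh).
Proof. by move=> dgx dhx; have := is_deriveB dgx dhx. Qed.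

Lemma is_derive1_chain g h x dg dh : is_derive (h x) 1 g dg ->
  is_derive x 1 h dh -> is_derive x 1 (fun y => g (h y)) (dg * dh).
Proof. by move=> dgx dhx; have := is_derive1_comp dgx dhx. Qed.

Lemma is_derive1_continuous g x dg : is_derive x 1 g dg ->
  g y @[y --> x] --> g x.
Proof.
by move=> dgx; apply: differentiable_continuous; exact/derivable1_diffP.
Qed.

Lemma is_derive1_shift (c x : R) : is_derive x 1 (fun y => y - c) 1.
Proof.
by have := is_derive1B (is_derive_id x 1) (is_derive_cst c x 1); rewrite subr0.
Qed.

Lemma is_derive_expRM (c x : R) :
  is_derive x 1 (fun y => expR (c * y)) (c * expR (c * x)).
Proof.
have dK : is_derive x 1 (fun y : R => c * y) (0 * x + c * 1).
  by apply: is_derive1M; exact: is_derive_id.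
have := @is_derive1_chain expR (fun y => c * y) x _ _ (is_derive_expR _) dK.
by move=> /is_derive_eq; apply; ring.
Qed.

Lemma is_derive_expR_affine (c x0 x : R) :
  is_derive x 1 (fun y => expR (c * (y - x0))) (c * expR (c * (x - x0))).
Proof.
have := @is_derive1_chain (fun y => expR (c * y)) (fun y => y - x0) x _ _
  (is_derive_expRM c (x - x0)) (is_derive1_shift x0 x).
by rewrite mulr1.
Qed.

Lemma continuous_expRM (c : R) : continuous (fun x : R => expR (c * x)).
Proof. by move=> x; exact: is_derive1_continuous (is_derive_expRM c x). Qed.

Lemma last_min_derivative g (t0 t dg : R) :
  t0 < t -> is_derive t 1 g dg -> (forall s, t0 <= s <= t -> g t <= g s) ->
  dg <= 0.
Proof.
move=> t0t [dgt gE] gmin; rewrite leNgt; apply/negP => dg0.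
have /cvgr_gt /(_ 0 dg0) [e /= e0 He] := cvg_toP dgt gE.
pose h := Num.min (e / 2) (t - t0).
have h0 : 0 < h by rewrite lt_min; lra.
have he : h <= e / 2 by rewrite ge_min lexx.
have ht : h <= t - t0 by rewrite ge_min lexx orbT.
have := He (- h); rewrite /= sub0r opprK gtr0_norm// oppr_eq0 gt_eqF//.
have gg : g t <= g (- h + t) by apply: gmin; lra.
rewrite /GRing.scale /= mulr1 invrN mulNr oppr_gt0 pmulr_rlt0 ?invr_gt0// subr_lt0.
by move=> /(_ ltac:(lra) isT); rewrite ltNge gg.
Qed.

End Differentiation.

(** * One-sided second-order expansions *)

Section Jets.
Context {R : realType}.
Implicit Types (F : set_system R) (g h X : R -> R) (x : R).

(** The statement is filter-generic so that one set of closure lemmas serves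
    both one-sided neighbourhoods [x^'-] and [x^'+]: derivatives are two-sided at
    the points near [x], and only their limits at [x] are one-sided. *)
Definition jet2 F x g g1 g2 : Prop :=
  [/\ \forall y \near F, is_derive (y : R) 1 g (g1 y),
      \forall y \near F, is_derive (y : R) 1 g1 (g2 y)
    & [/\ g y @[y --> F] --> g x, g1 y @[y --> F] --> g1 x
        & g2 y @[y --> F] --> g2 x]].

Lemma jet2B F x g g1 g2 h h1 h2 : Filter F ->
  jet2 F x g g1 g2 -> jet2 F x h h1 h2 ->
  jet2 F x (fun y => g y - h y) (fun y => g1 y - h1 y) (fun y => g2 y - h2 y).
Proof.
move=> FF [dg dg1 [cg cg1 cg2]] [dh dh1 [ch ch1 ch2]]; split.
- by apply: filterS2 dg dh => y; exact: is_derive1B.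
- by apply: filterS2 dg1 dh1 => y; exact: is_derive1B.
- by split; apply: cvgB.
Qed.

Lemma jet2M F x g g1 g2 h h1 h2 : Filter F ->
  jet2 F x g g1 g2 -> jet2 F x h h1 h2 ->
  jet2 F x (fun y => g y * h y) (fun y => g1 y * h y + g y * h1 y)
    (fun y => (g2 y * h y + g1 y * h1 y) + (g1 y * h1 y + g y * h2 y)).
Proof.
move=> FF [dg dg1 [cg cg1 cg2]] [dh dh1 [ch ch1 ch2]]; split.
- by apply: filterS2 dg dh => y; exact: is_derive1M.
- apply: filterS2 (filterI dg dg1) (filterI dh dh1) => y [? ?] [? ?].
  by apply: is_derive1D; exact: is_derive1M.
- split; first exact: cvgM cg ch.
    exact: cvgD (cvgM cg1 ch) (cvgM cg ch1).
  exact: cvgD (cvgD (cvgM cg2 ch) (cvgM cg1 ch1))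
              (cvgD (cvgM cg1 ch1) (cvgM cg ch2)).
Qed.

Lemma jet2_comp F x X X1 X2 h h1 h2 : Filter F ->
  (forall z : R, is_derive z 1 X (X1 z)) -> (forall z : R, is_derive z 1 X1 (X2 z)) ->
  continuous X2 -> jet2 F x h h1 h2 ->
  jet2 F x (fun y => X (h y)) (fun y => X1 (h y) * h1 y)
    (fun y => X2 (h y) * h1 y * h1 y + X1 (h y) * h2 y).
Proof.
move=> FF dX dX1 cX2 [dh dh1 [ch ch1 ch2]].
have cX y : X w @[w --> y] --> X y by exact: is_derive1_continuous.
have cX1 y : X1 w @[w --> y] --> X1 y by exact: is_derive1_continuous.
split.
- by apply: filterS dh => y; exact: is_derive1_chain.
- apply: filterS2 dh dh1 => y dhy dh1y.
  by apply: is_derive1M => //; exact: is_derive1_chain.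
- have cXh : X (h y) @[y --> F] --> X (h x) by apply: cvg_comp ch _; exact: cX.
  have cX1h : X1 (h y) @[y --> F] --> X1 (h x).
    by apply: cvg_comp ch _; exact: cX1.
  have cX2h : X2 (h y) @[y --> F] --> X2 (h x).
    by apply: cvg_comp ch _; exact: cX2.
  split=> //; first exact: cvgM cX1h ch1.
  exact: cvgD (cvgM (cvgM cX2h ch1) ch1) (cvgM cX1h ch2).
Qed.

Lemma near_rightP x (P : R -> Prop) : (\forall y \near x^'+, P y) <->
  exists2 e : R, 0 < e & forall y, x < y < x + e -> P y.
Proof.
split.
- case=> e /= e0 He; exists e => // y /andP[xy yxe]; apply: He => //=.
  by rewrite ltr0_norm ?subr_lt0// opprB ltrBlDl.
- case=> e e0 He; exists e => //= y /= yxe xy; apply: He.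
  by rewrite xy /=; move: yxe; rewrite ltr0_norm ?subr_lt0// opprB ltrBlDl.
Qed.

Lemma near_leftP x (P : R -> Prop) : (\forall y \near x^'-, P y) <->
  exists2 e : R, 0 < e & forall y, x - e < y < x -> P y.
Proof.
split.
- case=> e /= e0 He; exists e => // y /andP[xy yxe]; apply: He => //=.
  by rewrite gtr0_norm ?subr_gt0//; lra.
- case=> e e0 He; exists e => //= y /= yxe xy; apply: He.
  by rewrite xy andbT; move: yxe; rewrite gtr0_norm ?subr_gt0//; lra.
Qed.

(** The mean value theorem needs the limit of [g] at the end point only, so
    nothing is asked of the derivative there. *)
Lemma right_derivative_near_lt0 g g1 x :
  (\forall y \near x^'+, is_derive (y : R) 1 g (g1 y)) ->
  g y @[y --> x^'+] --> g x -> (\forall y \near x^'+, g1 y < 0) ->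
  \forall y \near x^'+, g y < g x.
Proof.
move=> dg cg ng.
have [e e0 He] := (near_rightP _ _).1 (filterI dg ng).
apply/near_rightP; exists e => // y /andP[xy yxe].
have dgy w : x < w <= y -> is_derive w 1 g (g1 w) by move=> ?; apply He; lra.
have cgy : {within `[x, y], continuous g}.
  apply/continuous_within_itvP => //; split => //.
    move=> w; rewrite in_itv /= => xwy; apply: is_derive1_continuous.
    by apply: dgy; lra.
  by apply: cvg_at_left_filter; apply: is_derive1_continuous; apply: dgy; lra.
have dgyo w : w \in `]x, y[ -> is_derive w 1 g (g1 w).
  by rewrite in_itv /= => xwy; apply: dgy; lra.
have [c] := MVT xy dgyo cgy.
rewrite in_itv /= => /andP[xc cy] gE.
have g1c : g1 c < 0 by apply He; lra.
by rewrite -subr_lt0 gE nmulr_rlt0// subr_gt0.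
Qed.

Lemma right_derivative_lt0 g g1 x (a : R) :
  (\forall y \near x^'+, is_derive (y : R) 1 g (g1 y)) ->
  g y @[y --> x^'+] --> g x -> g1 y @[y --> x^'+] --> a -> a < 0 ->
  \forall y \near x^'+, g y < g x.
Proof.
move=> dg cg cg1 a0; apply: (right_derivative_near_lt0 dg cg).
exact: (cvgr_lt a cg1 0 a0).
Qed.

Lemma left_derivative_gt0 g g1 x (a : R) :
  (\forall y \near x^'-, is_derive (y : R) 1 g (g1 y)) ->
  g y @[y --> x^'-] --> g x -> g1 y @[y --> x^'-] --> a -> 0 < a ->
  \forall y \near x^'-, g y < g x.
Proof.
move=> dg cg cg1 a0; have ng : \forall y \near x^'-, 0 < g1 y by exact: (cvgr_gt a cg1 0 a0).
have [e e0 He] := (near_leftP _ _).1 (filterI dg ng).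
apply/near_leftP; exists e => // y /andP[xey yx].
have dgy w : y <= w < x -> is_derive w 1 g (g1 w) by move=> ?; apply He; lra.
have cgy : {within `[y, x], continuous g}.
  apply/continuous_within_itvP => //; split => //.
    move=> w; rewrite in_itv /= => xwy; apply: is_derive1_continuous.
    by apply: dgy; lra.
  by apply: cvg_at_right_filter; apply: is_derive1_continuous; apply: dgy; lra.
have dgyo w : w \in `]y, x[ -> is_derive w 1 g (g1 w).
  by rewrite in_itv /= => xwy; apply: dgy; lra.
have [c] := MVT yx dgyo cgy.
rewrite in_itv /= => /andP[xc cy] gE.
have g1c : 0 < g1 c by apply He; lra.
by rewrite -subr_gt0 gE pmulr_rgt0// subr_gt0.
Qed.

Lemma right_min_derivative x p p1 p2 : jet2 x^'+ x p p1 p2 ->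
  (\forall y \near x^'+, p x <= p y) -> 0 <= p1 x.
Proof.
move=> [dp _ [cp cp1 _]] px; rewrite leNgt; apply/negP => p10.
have := right_derivative_lt0 dp cp cp1 p10.
move=> pn; have [e e0 /(_ (x + e / 2))] := (near_rightP _ _).1 (filterI px pn).
by case=> [|/le_lt_trans /[apply]]; [lra|rewrite ltxx].
Qed.

Lemma left_min_derivative x p p1 p2 : jet2 x^'- x p p1 p2 ->
  (\forall y \near x^'-, p x <= p y) -> p1 x <= 0.
Proof.
move=> [dp _ [cp cp1 _]] px; rewrite leNgt; apply/negP => p10.
have := left_derivative_gt0 dp cp cp1 p10.
move=> pn; have [e e0 /(_ (x - e / 2))] := (near_leftP _ _).1 (filterI px pn).
by case=> [|/le_lt_trans /[apply]]; [lra|rewrite ltxx].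
Qed.

Lemma right_min_second_derivative x p p1 p2 : jet2 x^'+ x p p1 p2 ->
  (\forall y \near x^'+, p x <= p y) -> p1 x = 0 -> 0 <= p2 x.
Proof.
move=> [dp dp1 [cp cp1 cp2]] px p10; rewrite leNgt; apply/negP => p20.
have := right_derivative_lt0 dp1 cp1 cp2 p20; rewrite p10 => p1n.
have pn := right_derivative_near_lt0 dp cp p1n.
 have [e e0 /(_ (x + e / 2))] := (near_rightP _ _).1 (filterI px pn).
by case=> [|/le_lt_trans /[apply]]; [lra|rewrite ltxx].
Qed.

(** At an interface only the signs [pl1 x <= 0 <= pr1 x] are available; the flux
    relation with a positive ratio [s] turns them into [pr1 x = 0], and the
    second derivative from the right is then nonnegative as at a smooth
    minimum. *)
Lemma transmitted_min x s p pl1 pl2 pr1 pr2 :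
  jet2 x^'- x p pl1 pl2 -> jet2 x^'+ x p pr1 pr2 ->
  0 < s -> pl1 x = s * pr1 x ->
  (\forall y \near x, p x <= p y) -> 0 <= pr2 x.
Proof.
move=> jl jr s0 flux pmin.
have pminl : \forall y \near x^'-, p x <= p y by exact: cvg_within.
have pminr : \forall y \near x^'+, p x <= p y by exact: cvg_within.
apply: (right_min_second_derivative jr pminr); apply/eqP; rewrite eq_le.
rewrite (right_min_derivative jr pminr) andbT.
by rewrite -(pmulr_rle0 _ s0) -flux (left_min_derivative jl pminl).
Qed.

End Jets.

(** * Functions that are C^2 up to the boundary of an interval *)

Section UpToTheBoundary.
Context {R : realType}.
Implicit Types (g h : R -> R) (a b x : R).

(** The derivatives at the end points are the limits of the interior ones, so
    that [g1] and [g2] may be evaluated on the closed interval. *)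
Definition C2_on a b g g1 g2 : Prop :=
  [/\ forall x, a < x < b -> is_derive x 1 g (g1 x),
      forall x, a < x < b -> is_derive x 1 g1 (g2 x)
    & (forall x, a <= x < b -> jet2 x^'+ x g g1 g2) /\
      (forall x, a < x <= b -> jet2 x^'- x g g1 g2)].

Lemma near_right_in a b x : a <= x < b -> \forall y \near x^'+, a < y < b.
Proof.
move=> xab; apply/near_rightP; exists (b - x); first lra.
by move=> y; lra.
Qed.

Lemma near_left_in a b x : a < x <= b -> \forall y \near x^'-, a < y < b.
Proof.
move=> xab; apply/near_leftP; exists (x - a); first lra.
by move=> y; lra.
Qed.

Lemma C2_onI a b g g1 g2 :
  (forall x, a < x < b -> is_derive x 1 g (g1 x)) ->
  (forall x, a < x < b -> is_derive x 1 g1 (g2 x)) ->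
  (forall x, a <= x < b -> [/\ g y @[y --> x^'+] --> g x,
     g1 y @[y --> x^'+] --> g1 x & g2 y @[y --> x^'+] --> g2 x]) ->
  (forall x, a < x <= b -> [/\ g y @[y --> x^'-] --> g x,
     g1 y @[y --> x^'-] --> g1 x & g2 y @[y --> x^'-] --> g2 x]) ->
  C2_on a b g g1 g2.
Proof.
move=> dg dg1 cr cl; split=> //; split=> x xab; split.
- by apply: filterS (near_right_in xab); exact: dg.
- by apply: filterS (near_right_in xab); exact: dg1.
- exact: cr.
- by apply: filterS (near_left_in xab); exact: dg.
- by apply: filterS (near_left_in xab); exact: dg1.
- exact: cl.
Qed.

Lemma C2_on_right a b g g1 g2 x :
  C2_on a b g g1 g2 -> a <= x < b -> jet2 x^'+ x g g1 g2.
Proof. by case=> _ _ [+ _]; exact. Qed.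

Lemma C2_on_left a b g g1 g2 x :
  C2_on a b g g1 g2 -> a < x <= b -> jet2 x^'- x g g1 g2.
Proof. by case=> _ _ [_]; exact. Qed.

Lemma derivative_within_is_derive a b g g1 x :
  derivative_within `[a, b] g g1 -> a < x < b -> is_derive x 1 g (g1 x).
Proof.
move=> dg xab.
have gx : h^-1 *: ((g \o shift x) (h *: (1 : R)) - g x) @[h --> 0^'] --> g1 x.
  apply/cvgrPdist_lt => e e0.
  have xab' : [set` `[a, b]] x by rewrite /= in_itv /=; lra.
  have /cvgrPdist_lt /(_ e e0) [del /= del0 H] := dg x xab'.
  exists (Num.min del (Num.min (x - a) (b - x))).
    by rewrite /= !lt_min del0 !subr_gt0.
  move=> h /=; rewrite sub0r normrN !lt_min => /and3P[hdel hxa hxb] h0.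
  have := H (h + x); rewrite /= opprD addrCA subrr addr0 normrN /GRing.scale /=.
  rewrite mulr1 addrK -[h + x == x]subr_eq0 addrK mulrC; apply => //.
  by rewrite in_itv /=; move: hxa hxb; rewrite !ltr_norml; lra.
have cx : derivable g x 1 by apply/cvg_ex; exists (g1 x).
by apply: DeriveDef => //; apply/cvg_lim.
Qed.

Lemma cvg_right_within a b x : a <= x < b ->
  (fun y : R => y) @ x^'+ --> within `[a, b] x^'.
Proof.
move=> xab P [e /= e0 H].
apply/near_rightP; exists (Num.min e (b - x)); first by rewrite lt_min e0 /=; lra.
move=> y; case/andP=> xy; rewrite -ltrBlDl lt_min => /andP[ye yb].
apply: H => /=; first by rewrite ltr0_norm ?subr_lt0//; lra.
- by rewrite gt_eqF.
- by rewrite in_itv /=; lra.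
Qed.

Lemma cvg_left_within a b x : a < x <= b ->
  (fun y : R => y) @ x^'- --> within `[a, b] x^'.
Proof.
move=> xab P [e /= e0 H].
apply/near_leftP; exists (Num.min e (x - a)); first by rewrite lt_min e0 /=; lra.
move=> y; case/andP=> xy yx.
have : x - y < Num.min e (x - a) by lra.
rewrite lt_min => /andP[ye yb].
apply: H => /=; first by rewrite gtr0_norm ?subr_gt0//; lra.
- by rewrite lt_eqF.
- by rewrite in_itv /=; lra.
Qed.

Lemma derivative_within_cvg F a b g g1 x {FF : Filter F} :
  derivative_within `[a, b] g g1 -> a <= x <= b ->
  (fun y : R => y) @ F --> within `[a, b] x^' -> g y @[y --> F] --> g x.
Proof.
move=> dg xab Fx.
have xab' : [set` `[a, b]] x by rewrite /= in_itv /=; lra.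
have q := dg x xab'.
have w : (g y - g x) / (y - x) @[y --> F] --> g1 x by exact: cvg_comp Fx q.
have Fx' : y @[y --> F] --> x.
  apply: (cvg_trans Fx) => P [e /= e0 H]; exists e => //= y ye _ _; exact: H.
have v : g x + ((g y - g x) / (y - x)) * (y - x) @[y --> F] --> g x.
  rewrite -[X in _ --> X]addr0 -(mulr0 (g1 x)) -(subrr x).
  by apply: cvgD; [exact: cvg_cst|apply: cvgM => //; apply: cvgB => //;
    exact: cvg_cst].
apply: cvg_trans v; apply: near_eq_cvg.
have ne : \forall y \near F, y != x by apply: Fx; exists 1 => //= y.
apply: filterS ne => y yx; rewrite divfK ?subr_eq0//; first by rewrite addrC subrK.
Qed.

Lemma C2_on_within a b g g1 g2 :
  derivative_within `[a, b] g g1 -> derivative_within `[a, b] g1 g2 ->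
  (forall x, a <= x < b -> g2 y @[y --> x^'+] --> g2 x) ->
  (forall x, a < x <= b -> g2 y @[y --> x^'-] --> g2 x) ->
  C2_on a b g g1 g2.
Proof.
move=> dg dg1 cr cl; apply: C2_onI.
- by move=> x; exact: derivative_within_is_derive.
- by move=> x; exact: derivative_within_is_derive.
- move=> x xab; split; last exact: cr.
  + by apply: derivative_within_cvg dg _ _; [lra|exact: cvg_right_within].
  + by apply: derivative_within_cvg dg1 _ _; [lra|exact: cvg_right_within].
- move=> x xab; split; last exact: cl.
  + by apply: derivative_within_cvg dg _ _; [lra|exact: cvg_left_within].
  + by apply: derivative_within_cvg dg1 _ _; [lra|exact: cvg_left_within].
Qed.

Lemma near_in a b x : a < x < b -> \forall y \near x, a < y < b.
Proof.
move=> xab; exists (Num.min (x - a) (b - x)); first by rewrite /= lt_min; lra.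
by move=> y /=; rewrite lt_min !ltr_norml; lra.
Qed.

Lemma C2_on_derive1 a b g g1 g2 x : C2_on a b g g1 g2 -> a < x < b ->
  derive1 g x = g1 x.
Proof. by case=> dg _ _ xab; rewrite derive1E; have := dg x xab; case. Qed.

Lemma C2_on_derive2 a b g g1 g2 x : C2_on a b g g1 g2 -> a < x < b ->
  derive1n 2 g x = g2 x.
Proof.
move=> Cg xab; rewrite /= derive1E.
have -> : 'D_1 (derive1 g) x = 'D_1 g1 x.
  apply: near_eq_derive; apply: filterS (near_in xab) => y.
  exact: C2_on_derive1 Cg.
by case: Cg => _ /(_ x xab) [].
Qed.

Lemma C2_on_left_limit a b g g1 g2 : C2_on a b g g1 g2 -> a < b ->
  left_limit (derive1 g) b = g1 b.
Proof.
move=> Cg ab; apply: cvg_lim => //.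
have b1 : a < b <= b by rewrite ab lexx.
have [_ _ [_ /(_ b b1) [_ _ [_ cg1 _]]]] := Cg.
apply: (cvg_trans _ cg1); apply: near_eq_cvg.
by apply: filterS (near_left_in b1) => y /(C2_on_derive1 Cg).
Qed.

Lemma C2_on_right_limit a b g g1 g2 : C2_on a b g g1 g2 -> a < b ->
  right_limit (derive1 g) a = g1 a.
Proof.
move=> Cg ab; apply: cvg_lim => //.
have b1 : a <= a < b by rewrite ab lexx.
have [_ _ [/(_ a b1) [_ _ [_ cg1 _]] _]] := Cg.
apply: (cvg_trans _ cg1); apply: near_eq_cvg.
by apply: filterS (near_right_in b1) => y /(C2_on_derive1 Cg).
Qed.

Lemma cvg_slice (v : R -> R -> R) a b t x (F : set_system R) {FF : Filter F} :
  {within [set s : R | 0 < s] `*` `[a, b],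
    continuous (fun p : R * R => v p.1 p.2 : R)} ->
  0 < t -> a <= x <= b -> (fun y : R => y) @ F --> within `[a, b] x^' ->
  v t y @[y --> F] --> v t x.
Proof.
move=> /subspace_continuousP cv t0 xab Fx.
have txab : ([set s : R | 0 < s] `*` `[a, b]) (t, x).
  by split => //=; rewrite in_itv.
have := cv (t, x) txab => /= vtx.
suff Ht : (fun y : R => (t, y)) @ F -->
    within ([set s : R | 0 < s] `*` `[a, b]) (nbhs (t, x)).
  exact: (cvg_comp _ _ Ht vtx).
move=> P [[A B] /= [At Bx] H].
have FA : \forall y \near F, B y /\ [set` `[a, b]] y.
  apply: Fx; case: Bx => e /= e0 He; exists e => //= y ye _ yab; split => //.
  exact: He.
apply: filterS FA => y [By yab]; apply: H => //=; split => //=.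
exact: nbhs_singleton.
Qed.

(** Extends to an interface, from the right, an equation that holds only inside
    the patches. *)
Lemma right_cvg_unique (g h : R -> R) x : g y @[y --> x^'+] --> g x ->
  h y @[y --> x^'+] --> h x -> (\forall y \near x^'+, g y = h y) -> g x = h x.
Proof.
move=> cg ch gh; have hg : h y @[y --> x^'+] --> g x.
  apply: (cvg_trans _ cg); apply: near_eq_cvg.
  by apply: filterS gh => y ->.
by rewrite -(cvg_lim _ ch)// (cvg_lim _ hg).
Qed.

End UpToTheBoundary.

(** * Geometry of the patches *)

Section Patches.
Context {R : realType} (l1 l2 d1 d2 sigma : R) (f1 f2 : R -> R).
Context (hl1 : 0 < l1) (hl2 : 0 < l2) (hsigma : 0 < sigma).
Local Notation L := (period l1 l2).

Definition patch (j : bool) (a b : R) :=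
  if j then patch1 l1 l2 a b else patch2 l1 l2 a b.
Definition dpatch (j : bool) := if j then d1 else d2.
Definition fpatch (j : bool) := if j then f1 else f2.
(** The piecewise affine map with these slopes satisfies the flux conditions, so
    differentiating with respect to it removes the jumps at the interfaces. *)
Definition slope (j : bool) : R := if j then sigma else 1.

Lemma period_gt0 : 0 < L. Proof. exact: addr_gt0. Qed.

Lemma patch_lt j a b : patch j a b -> a < b.
Proof. by case: j => -[n [-> ->]]; rewrite ?ltrBlDr ltrDl. Qed.

Lemma is_patch_patch j a b : patch j a b -> is_patch l1 l2 a b.
Proof. by case: j; [left|right]. Qed.

Lemma intmul_le (n m : int) :
  n%:~R * L < m%:~R * L + L -> n%:~R * L <= m%:~R * L.
Proof.
rewrite -[X in _ + X]mul1r -mulrDl ltr_pM2r ?period_gt0//.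
have -> : m%:~R + 1 = (m + 1)%:~R :> R by rewrite intrD.
by rewrite ltr_int ltzD1 ler_pM2r ?period_gt0// ler_int.
Qed.

Lemma patch_interior j a b x : patch j a b -> a < x < b ->
  [/\ diffusion l1 l2 d1 d2 x = dpatch j, reaction l1 l2 f1 f2 x = fpatch j
    & ~ interfaces l1 l2 x].
Proof.
move=> pj xab; have LE : L = l1 + l2 by [].
have [l1_gt0 l2_gt0] := (hl1, hl2).
have in1 : in_patch1 l1 l2 x <-> j.
  case: j pj => pj; first by split => // _; exists a, b.
  split=> // -[c [d [[n [cE dE]] xcd]]]; case: pj => m [aE bE].
  have : n%:~R * L < m%:~R * L + L by lra.
  by move/intmul_le; lra.
have notS : ~ interfaces l1 l2 x.
  case: j pj {in1} => -[n [aE bE]] [[m _ xE]|[m _ xE]]; apply: notF;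
    have nm := @intmul_le n m; have mn := @intmul_le m n;
    move: (n%:~R * L) (m%:~R * L) aE bE xE nm mn => N M aE bE xE nm mn;
    first [suff /nm H : N < M + L by lra|suff /mn H : M < N + L by lra]; lra.
split=> //; rewrite /diffusion /reaction; case: asboolP => [/in1 ->//|nj];
  by case: j pj in1 nj => // _ [_ /(_ isT)].
Qed.

(** A point [x] seen from the patch [al, bl] on its left and the patch [ar, br]
    on its right; [s] is the ratio of the one-sided derivatives that the flux
    conditions prescribe, and it is 1 inside a patch. *)
Definition transmission x (i j : bool) (al bl ar br s : R) : Prop :=
  [/\ patch i al bl /\ al < x <= bl, patch j ar br /\ ar <= x < br,
      0 < s /\ slope i = s * slope j
    & forall g gl1 gl2 gr1 gr2, C2_on al bl g gl1 gl2 ->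
        C2_on ar br g gr1 gr2 -> flux_conditions l1 l2 sigma g ->
        gl1 x = s * gr1 x].

Lemma point_sides x : exists i j al bl ar br s,
  transmission x i j al bl ar br s.
Proof.
have interior j a b : patch j a b -> a < x < b ->
    exists i j al bl ar br s, transmission x i j al bl ar br s.
  move=> pj xab; exists j, j, a, b, a, b, 1; split.
  - by split => //; lra.
  - by split => //; lra.
  - by rewrite mul1r.
  - move=> g gl1 gl2 gr1 gr2 Cl Cr _; rewrite mul1r.
    by rewrite -(C2_on_derive1 Cl)// -(C2_on_derive1 Cr).
pose n := Num.floor (x / L); have L0 := period_gt0.
have nx : n%:~R * L <= x < n%:~R * L + L.
  have := floor_itv (x / L); rewrite -/n intrD ler_pdivlMr// ltr_pdivrMr//.
  by rewrite mulrDl mul1r.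
have SE : (n + 1)%:~R * L = n%:~R * L + L by rewrite intrD mulrDl mul1r.
have p2 : patch false (n%:~R * L) (n%:~R * L + l2) by exists n.
have p1 : patch true (n%:~R * L + l2) (n%:~R * L + L).
  by exists (n + 1); rewrite SE; split=> //; rewrite /period; ring.
have p0 : patch true (n%:~R * L - l1) (n%:~R * L) by exists n.
have LE : L = l1 + l2 by [].
have [l1_gt0 l2_gt0] := (hl1, hl2).
have [xE|xn] := eqVneq x (n%:~R * L).
  exists true, false, (n%:~R * L - l1), (n%:~R * L), (n%:~R * L),
    (n%:~R * L + l2), sigma; split.
  - by split=> //; lra.
  - by split=> //; lra.
  - by rewrite mulr1.
  - move=> g gl1 gl2 gr1 gr2 Cl Cr [fl _].
    have := fl x; rewrite xE (C2_on_left_limit Cl) ?(patch_lt p0)//.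
    by rewrite (C2_on_right_limit Cr) ?(patch_lt p2)//; apply; exists n.
have [xlt|xgt|xE] := ltgtP x (n%:~R * L + l2).
- apply: (interior _ _ _ p2); rewrite xlt andbT lt_neqAle eq_sym xn /=.
  by case/andP: nx.
- by apply: (interior _ _ _ p1); lra.
exists false, true, (n%:~R * L), (n%:~R * L + l2), (n%:~R * L + l2),
  (n%:~R * L + L), sigma^-1; split.
- by split=> //; lra.
- by split=> //; lra.
- by rewrite invr_gt0 mulVf ?gt_eqF.
- move=> g gl1 gl2 gr1 gr2 Cl Cr [_ fl].
  have := fl x; rewrite xE (C2_on_left_limit Cl) ?(patch_lt p2)//.
  rewrite (C2_on_right_limit Cr) ?(patch_lt p1)// => <-; last by exists n.
  by rewrite mulKf ?gt_eqF.
Qed.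

Section Solutions.
Context (cf : forall j, continuous (fpatch j)).

Lemma solution_on_patch u0 u j a b t :
  patch_solution l1 l2 d1 d2 sigma f1 f2 u0 u -> patch j a b -> 0 < t ->
  exists ut ux uxx, [/\ C2_on a b (u t) ux uxx,
    forall x, a <= x < b -> is_derive t 1 (u^~ x) (ut x)
  & forall x, a <= x < b -> ut x - dpatch j * uxx x = fpatch j (u t x)].
Proof.
move=> [_ _ _ C12 [pde _ _]] pj t0.
have [ut [ux [uxx [dt dx dxx [cu cut _ cuxx]]]]] := C12 _ _ (is_patch_patch pj).
have C2 : C2_on a b (u t) (ux t) (uxx t).
  apply: C2_on_within; [exact: dx|exact: dxx| |] => x xab.
    by apply: (cvg_slice cuxx) => //; [lra|exact: cvg_right_within].
  by apply: (cvg_slice cuxx) => //; [lra|exact: cvg_left_within].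
have dut x : a <= x < b -> is_derive t 1 (u^~ x) (ut t x).
  by move=> xab; apply: dt => //; rewrite /= in_itv /=; lra.
exists (ut t), (ux t), (uxx t); split=> // x xab.
have sl v : {within [set s : R | 0 < s] `*` `[a, b],
    continuous (fun p : R * R => v p.1 p.2 : R)} -> v t y @[y --> x^'+] --> v t x.
  by move=> cv; apply: (cvg_slice cv) => //; [lra|exact: cvg_right_within].
apply: (@right_cvg_unique R (fun y => ut t y - dpatch j * uxx t y)
   (fun y => fpatch j (u t y))).
- by apply: cvgB; [exact: sl|apply: cvgM; [exact: cvg_cst|exact: sl]].
- by apply: cvg_comp (sl _ cu) _; exact: cf.
- apply: filterS (near_right_in xab) => y yab.
  have [dE fE yS] := patch_interior pj yab.
  have := pde t y t0 yS; rewrite dE fE (C2_on_derive2 C2)// => <-.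
  have [_ <-] : is_derive t 1 (u^~ y) (ut t y) by apply: dut; lra.
  by rewrite derive1E.
Qed.

Lemma eigenfunction_on_patch lambda phi j a b :
  principal_eigenfunction l1 l2 d1 d2 sigma f1 f2 lambda phi -> patch j a b ->
  exists phi1 phi2, C2_on a b phi phi1 phi2 /\ forall x, a <= x < b ->
    - dpatch j * phi2 x - derive1 (fpatch j) 0 * phi x = lambda * phi x.
Proof.
move=> [[cphi smooth] eqn _ _ _] pj.
have [D [D0 dD]] := smooth _ _ (is_patch_patch pj).
have C2 : C2_on a b phi (D 1%N) (D 2%N).
  rewrite -D0; apply: C2_on_within; [exact: dD|exact: dD| |] => x xab.
    by apply: derivative_within_cvg (dD 2%N) _ _; [lra|exact: cvg_right_within].
  by apply: derivative_within_cvg (dD 2%N) _ _; [lra|exact: cvg_left_within].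
exists (D 1%N), (D 2%N); split=> // x xab.
have [_ _ [/(_ x xab) [_ _ [c0 _ c2]] _]] := C2.
apply: (@right_cvg_unique R
   (fun y => - dpatch j * D 2%N y - derive1 (fpatch j) 0 * phi y)
   (fun y => lambda * phi y)).
- by apply: cvgB; apply: cvgM => //; exact: cvg_cst.
- by apply: cvgM => //; exact: cvg_cst.
- apply: filterS (near_right_in xab) => y yab.
  have [dE fE yS] := patch_interior pj yab.
  by have := eqn y yS; rewrite dE fE (C2_on_derive2 C2).
Qed.

End Solutions.
End Patches.

(** * Touching a solution from below *)

Section Touching.
Context {R : realType} (l1 l2 d1 d2 sigma : R) (f1 f2 : R -> R).
Context (hl1 : 0 < l1) (hl2 : 0 < l2) (hsigma : 0 < sigma).
Context (hd1 : 0 < d1) (hd2 : 0 < d2).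
Context (lambda : R) (phi : R -> R).
Context (hphi : principal_eigenfunction l1 l2 d1 d2 sigma f1 f2 lambda phi).
Context (cf : forall j, continuous (fpatch f1 f2 j)).

Local Notation patch := (patch l1 l2).
Local Notation d := (dpatch d1 d2).
Local Notation f := (fpatch f1 f2).
Local Notation k := (slope sigma).

(** Here [phi * X(z)] solves the eigenvalue equation up to the single term
    [d k^2 X''(z) / phi^3]: the first-order terms in [X'] cancel exactly because
    [phi^2 z'] is constant on each patch. In particular [phi * z] is, for the
    eigenvalue equation, the second solution obtained by reduction of order. *)
Definition is_phase (z : R -> R) : Prop := continuous z /\
  forall j a b phi1 phi2, patch j a b -> C2_on a b phi phi1 phi2 ->
  C2_on a b z (fun x => k j / phi x ^+ 2)
    (fun x => - (2 * k j * phi1 x / phi x ^+ 3)).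

Lemma phi_gt0 x : 0 < phi x. Proof. by case: hphi => _ _ _ _ []. Qed.

Context (z : R -> R) (hz : is_phase z).
Context (u0 : R -> R) (u : R -> R -> R).
Context (hu : patch_solution l1 l2 d1 d2 sigma f1 f2 u0 u).

(** Where [phi * X(z)] first touches [u] from below, [u - phi * X(z)] has a
    minimum in [x] and has just decreased to zero in [t]. If [x] is an interface,
    the flux conditions of [u], [phi] and [z] make this minimum a critical point,
    so the second-order test applies on the patch to the right. The equation for
    [u] then becomes a differential inequality for [X] alone. *)
Lemma touching_from_below (X X1 X2 Y : R -> R) (dY t0 t x : R) :
  (forall w : R, is_derive w 1 X (X1 w)) ->
  (forall w : R, is_derive w 1 X1 (X2 w)) -> continuous X2 ->
  0 <= t0 < t -> is_derive t 1 Y dY -> Y t = X (z x) ->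
  u t x = phi x * X (z x) ->
  (\forall y \near x, phi y * X (z y) <= u t y) ->
  (forall s, t0 <= s <= t -> phi x * Y s <= u s x) ->
  exists j, d j * k j ^+ 2 / phi x ^+ 3 * X2 (z x)
    - (derive1 (f j) 0 + lambda) * (phi x * X (z x)) + f j (phi x * X (z x))
    <= phi x * dY.
Proof.
move=> dX dX1 cX2 t0t dYt YE uE unear upast.
have t_gt0 : 0 < t by lra.
have [i [j [al [bl [ar [br [s [[pi xl] [pj xr] [s0 sk] flux]]]]]]]] :=
  point_sides hl1 hl2 hsigma x.
have [_ [uxl [uxxl [Cul _ _]]]] :=
  solution_on_patch hl1 hl2 cf hu pi t_gt0.
have [ut [uxr [uxxr [Cur dut pde]]]] :=
  solution_on_patch hl1 hl2 cf hu pj t_gt0.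
have [pl1 [pl2 [Cpl _]]] := eigenfunction_on_patch hl1 hl2 hphi pi.
have [pr1 [pr2 [Cpr eqn]]] := eigenfunction_on_patch hl1 hl2 hphi pj.
have Czl := hz.2 _ _ _ _ _ pi Cpl; have Czr := hz.2 _ _ _ _ _ pj Cpr.
have fluxu := flux _ _ _ _ _ Cul Cur; have fluxp := flux _ _ _ _ _ Cpl Cpr.
have px := phi_gt0 x.
have Fl : Filter (x^'- : set_system R) by exact: at_left_proper_filter.
have Fr : Filter (x^'+ : set_system R) by exact: at_right_proper_filter.
have jl := jet2B Fl (C2_on_left Cul xl) (jet2M Fl (C2_on_left Cpl xl)
  (jet2_comp Fl dX dX1 cX2 (C2_on_left Czl xl))).
have jr := jet2B Fr (C2_on_right Cur xr) (jet2M Fr (C2_on_right Cpr xr)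
  (jet2_comp Fr dX dX1 cX2 (C2_on_right Czr xr))).
have umin : \forall y \near x, u t x - phi x * X (z x) <= u t y - phi y * X (z y).
  by apply: filterS unear => y; rewrite uE; lra.
have fluxl : uxl x - (pl1 x * X (z x) + phi x * (X1 (z x) * (k i / phi x ^+ 2)))
    = s * (uxr x - (pr1 x * X (z x) + phi x * (X1 (z x) * (k j / phi x ^+ 2)))).
  have -> : uxl x = s * uxr x by apply: fluxu; case: hu => _ _ _ _ [_ _ /(_ t t_gt0)].
  have -> : pl1 x = s * pr1 x by apply: fluxp; case: hphi.
  by rewrite sk; ring.
have := transmitted_min jl jr s0 fluxl umin.
have -> : uxxr x - (pr2 x * X (z x) + pr1 x * (X1 (z x) * (k j / phi x ^+ 2)) +
   (pr1 x * (X1 (z x) * (k j / phi x ^+ 2)) +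
    phi x * (X2 (z x) * (k j / phi x ^+ 2) * (k j / phi x ^+ 2) +
      X1 (z x) * - (2 * k j * pr1 x / phi x ^+ 3)))) =
  uxxr x - (pr2 x * X (z x) + k j ^+ 2 / phi x ^+ 3 * X2 (z x)).
  by field; rewrite gt_eqF.
move=> uxx_ge.
have ut_le : ut x - phi x * dY <= 0.
  have dphiY : is_derive t 1 (fun s => phi x * Y s) (0 * Y t + phi x * dY).
    exact: is_derive1M.
  have := is_derive1B (dut x xr) dphiY; rewrite mul0r add0r => dB.
  have t0t' : t0 < t by lra.
  apply: (last_min_derivative t0t' dB) => w tw.
  by rewrite uE YE subrr subr_ge0 upast.
have := pde x xr; have := eqn x xr; rewrite uE => eqnx pdex.
have dj : 0 < d j by rewrite /dpatch; case: (j).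
exists j; have := mulr_ge0 (ltW dj) uxx_ge.
have -> : d j * (uxxr x - (pr2 x * X (z x) + k j ^+ 2 / phi x ^+ 3 * X2 (z x)))
  = d j * uxxr x - (d j * pr2 x) * X (z x)
    - d j * k j ^+ 2 / phi x ^+ 3 * X2 (z x) by ring.
have -> : d j * pr2 x = - (derive1 (f j) 0 + lambda) * phi x.
  by rewrite mulNr mulrDl -eqnx; ring.
by lra.
Qed.

End Touching.

(** * The phase *)

Lemma periodic_int {R : realType} (g : R -> R) (p : R) (n : int) x :
  periodic g p -> g (x - n%:~R * p) = g x.
Proof.
move=> gp; have gn (m : nat) y : g (y + m%:R * p) = g y.
  by rewrite mulr_natl periodicn.
case: n => n; last by rewrite NegzE mulrNz mulNr opprK -pmulrn gn.
by rewrite -[in RHS](subrK (n%:R * p) x) -pmulrn gn.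
Qed.

Lemma periodic_bounds {R : realType} (g : R -> R) (p : R) : 0 < p ->
  continuous g -> periodic g p -> exists x1 x2, forall x, g x1 <= g x <= g x2.
Proof.
move=> p0 cg gp.
have cg' : {within `[0, p], continuous g} by exact: continuous_subspaceT.
have [x1 _ m1] := EVT_min (ltW p0) cg'; have [x2 _ m2] := EVT_max (ltW p0) cg'.
exists x1, x2 => x; rewrite -(periodic_int (Num.floor (x / p)) x gp).
have : x - (Num.floor (x / p))%:~R * p \in `[0, p].
  have := floor_itv (x / p); rewrite intrD ler_pdivlMr// ltr_pdivrMr//.
  by rewrite mulrDl mul1r in_itv /=; lra.
by move=> xp; rewrite m1// m2.
Qed.

Lemma primitive_on {R : realType} (g : R -> R) (a b : R) : a < b ->
  continuous g -> exists G : R -> R, forall x, a < x < b -> is_derive x 1 G (g x).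
Proof.
move=> ab cg; exists (fun x => \int[lebesgue_measure]_(t in `[a, x]) g t) => x.
move=> /andP[ax xb].
have ig : lebesgue_measure.-integrable `[a, b] (EFin \o g).
  apply: continuous_compact_integrable; first exact: segment_compact.
  exact: continuous_subspaceT.
have [dG GE] := continuous_FTC1_closed xb ig ax (cg x).
by split; [exact: dG|rewrite -derive1E].
Qed.

Section Phase.
Context {R : realType} (l1 l2 d1 d2 sigma : R) (f1 f2 : R -> R).
Context (hl1 : 0 < l1) (hl2 : 0 < l2) (hsigma : 0 < sigma).
Context (hd1 : 0 < d1) (hd2 : 0 < d2).
Context (lambda : R) (phi : R -> R).
Context (hphi : principal_eigenfunction l1 l2 d1 d2 sigma f1 f2 lambda phi).

Local Notation patch := (patch l1 l2).
Local Notation d := (dpatch d1 d2).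
Local Notation k := (slope sigma).
Local Notation L := (period l1 l2).
Local Notation is_phase := (is_phase l1 l2 sigma phi).

Let phi_pos x : 0 < phi x. Proof. exact: phi_gt0 hphi x. Qed.
Let phi_cont : continuous phi. Proof. by case: hphi => -[]. Qed.
Let phi_per : periodic phi L. Proof. by case: hphi. Qed.

Lemma eigenfunction_bounds :
  exists m M, [/\ 0 < m, 0 < M & forall x, m <= phi x <= M].
Proof.
have [x1 [x2 H]] := periodic_bounds (period_gt0 hl1 hl2) phi_cont phi_per.
by exists (phi x1), (phi x2).
Qed.

Lemma C2_on_slope a b c phi1 phi2 (g : R -> R) : C2_on a b phi phi1 phi2 ->
  (forall x, a < x < b -> is_derive x 1 g (c / phi x ^+ 2)) ->
  (forall x, a <= x < b -> g y @[y --> x^'+] --> g x) ->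
  (forall x, a < x <= b -> g y @[y --> x^'-] --> g x) ->
  C2_on a b g (fun x => c / phi x ^+ 2) (fun x => - (2 * c * phi1 x / phi x ^+ 3)).
Proof.
move=> Cphi dg cr cl.
have lims F x : Filter F -> phi y @[y --> F] --> phi x ->
    phi1 y @[y --> F] --> phi1 x ->
    c / phi y ^+ 2 @[y --> F] --> c / phi x ^+ 2 /\
    - (2 * c * phi1 y / phi y ^+ 3) @[y --> F] --> - (2 * c * phi1 x / phi x ^+ 3).
  move=> FF cp cp1.
  have cp2 : phi y ^+ 2 @[y --> F] --> phi x ^+ 2 by exact: (cvgM cp cp).
  have cp3 : phi y ^+ 3 @[y --> F] --> phi x ^+ 3 by exact: (cvgM cp cp2).
  have px n : phi x ^+ n != 0 by rewrite expf_neq0 ?gt_eqF.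
  split; first by apply: cvgM; [exact: cvg_cst|exact: cvgV].
  apply: cvgN; apply: cvgM; last exact: cvgV.
  by apply: cvgM => //; exact: cvg_cst.
apply: C2_onI => //.
- move=> x xab; have [/(_ x xab) dphi _ _] := Cphi.
  have nz : phi x * phi x != 0 by rewrite mulf_neq0 ?gt_eqF.
  have := is_derive1M (is_derive_cst c x 1)
    (@is_deriveV R (fun y => phi y * phi y) x _ _ nz (is_derive1M dphi dphi)).
  rewrite mul0r add0r => /is_derive_eq; apply; rewrite /GRing.scale /=.
  by field; rewrite gt_eqF.
- move=> x xab; split; first exact: cr.
  + by have [_ _ [cphi cphi1 _]] := C2_on_right Cphi xab; have [] := lims _ x _ cphi cphi1.
  + by have [_ _ [cphi cphi1 _]] := C2_on_right Cphi xab; have [] := lims _ x _ cphi cphi1.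
- move=> x xab; split; first exact: cl.
  + by have [_ _ [cphi cphi1 _]] := C2_on_left Cphi xab; have [] := lims _ x _ cphi cphi1.
  + by have [_ _ [cphi cphi1 _]] := C2_on_left Cphi xab; have [] := lims _ x _ cphi cphi1.
Qed.

(** On one period the phase is glued from a primitive of [phi^-2], multiplied by
    the slope of the patch; [P] is its increment over a period, the same
    for all periods because [phi] is periodic. *)
Lemma phase_exists : exists z, is_phase z.
Proof.
have L0 := period_gt0 hl1 hl2; have LE : L = l1 + l2 by [].
have [l1_gt0 l2_gt0] := (hl1, hl2).
have cinv : continuous (fun x => (phi x ^+ 2)^-1).
  move=> x; apply: cvgV; first by rewrite expf_neq0 ?gt_eqF.
  by apply: cvgM; exact: phi_cont.
have [|Z dZ] := @primitive_on R _ (-1) (L + 1) _ cinv; first by lra.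
pose z0 y := if y <= l2 then Z y - Z 0 else Z l2 - Z 0 + sigma * (Z y - Z l2).
pose P := z0 L.
pose n x := Num.floor (x / L).
pose z x := (n x)%:~R * P + z0 (x - (n x)%:~R * L).
have nE (m : int) x : m%:~R * L <= x < m%:~R * L + L -> n x = m.
  move=> xm; apply: floor_def; rewrite -/(n x).
  by rewrite ler_pdivlMr// ltr_pdivrMr// intrD mulrDl mul1r.
have z00 : z0 0 = 0 by rewrite /z0 ltW// subrr.
have PE : P = Z l2 - Z 0 + sigma * (Z L - Z l2).
  by rewrite /P /z0 ifF//; apply/negbTE; rewrite -ltNge; lra.
have z_on j a b : patch j a b -> exists C m, forall y, a <= y <= b ->
    z y = C + k j * Z (y - m%:~R * L) /\ 0 <= y - m%:~R * L <= L.
  case: j => -[m [aE bE]].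
    pose m' := m - 1; have mI : m%:~R = m'%:~R + 1 :> R by rewrite /m' intrB subrK.
    have mE : m%:~R * L = m'%:~R * L + L by rewrite mI mulrDl mul1r.
    exists (m'%:~R * P + (Z l2 - Z 0 - sigma * Z l2)), m' => y yab; split; last by lra.
    (* The right end point is counted by floor in the next period. *)
    have [ym|ym] := eqVneq y (m%:~R * L).
      rewrite /z (nE m); last by lra.
      rewrite ym subrr z00 mI; have -> : (m'%:~R + 1) * L - m'%:~R * L = L by ring.
      by rewrite [in LHS]mulrDl mul1r {2}PE /=; ring.
    have ym' : y < m%:~R * L by rewrite lt_neqAle ym; lra.
    rewrite /z (nE m'); last by lra.
    rewrite /z0; case: ifPn => yl; last by rewrite /=; ring.
    have -> : y - m'%:~R * L = l2 by lra.
    by rewrite /=; ring.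
  exists (m%:~R * P - Z 0), m => y yab; split; last by lra.
  rewrite /z (nE m); last by lra.
  by rewrite /z0 ifT; [rewrite /=; ring|lra].
have dz j a b x C m : patch j a b -> a <= x <= b -> 0 <= x - m%:~R * L <= L ->
    is_derive x 1 (fun y => C + k j * Z (y - m%:~R * L)) (k j / phi x ^+ 2).
  move=> pj xab xm.
  have dshift : is_derive x 1 (fun y : R => y - m%:~R * L) (1 - 0).
    by apply: is_derive1B; exact: is_derive_id.
  have dZx : is_derive (x - m%:~R * L) 1 Z ((phi x ^+ 2)^-1).
    by rewrite -(periodic_int m x phi_per); apply: dZ; lra.
  have := is_derive1D (is_derive_cst C x 1) (is_derive1M (is_derive_cst (k j) x 1)
    (@is_derive1_chain R Z (fun y => y - m%:~R * L) x _ _ dZx dshift)).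
  by rewrite mul0r !add0r subr0 mulr1.
have C2z j a b phi1 phi2 : patch j a b -> C2_on a b phi phi1 phi2 ->
   C2_on a b z (fun x => k j / phi x ^+ 2) (fun x => - (2 * k j * phi1 x / phi x ^+ 3)).
  move=> pj Cphi; have [C [m zE]] := z_on _ _ _ pj.
  have zcont x : a <= x <= b ->
      (fun y => C + k j * Z (y - m%:~R * L)) y @[y --> x] --> z x.
    move=> xab; have [-> xm] := zE x xab.
    exact: is_derive1_continuous (dz _ _ _ _ _ _ pj xab xm).
  apply: C2_on_slope Cphi _ _ _ => x xab.
  - have xab' : a <= x <= b by lra.
    apply: near_eq_is_derive (dz _ _ _ _ C m pj xab' (zE x xab').2).
    by apply: filterS (near_in xab) => y yab; rewrite (zE y _).1//; lra.
  - have xab' : a <= x <= b by lra.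
    apply: (cvg_trans _ (cvg_at_right_filter (zcont x xab'))).
    apply: near_eq_cvg; apply: filterS (near_right_in xab) => y yab.
    by rewrite (zE y _).1//; lra.
  - have xab' : a <= x <= b by lra.
    apply: (cvg_trans _ (cvg_at_left_filter (zcont x xab'))).
    apply: near_eq_cvg; apply: filterS (near_left_in xab) => y yab.
    by rewrite (zE y _).1//; lra.
exists z; split=> // x.
have [i [j [al [bl [ar [br [s [[pi xl] [pj xr] _ _]]]]]]]] :=
  point_sides hl1 hl2 hsigma x.
have [? [? [Cl _]]] := eigenfunction_on_patch hl1 hl2 hphi pi.
have [? [? [Cr _]]] := eigenfunction_on_patch hl1 hl2 hphi pj.
have [_ _ [czl _ _]] := C2_on_left (C2z _ _ _ _ _ pi Cl) xl.
have [_ _ [czr _ _]] := C2_on_right (C2z _ _ _ _ _ pj Cr) xr.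
by apply/left_right_continuousP.
Qed.

(** If some chord of [z] had a slope [c] below the bound, [z - c x] would have a
    maximum that is not at the right end point; but there its right derivative
    [k / phi^2 - c] is positive. *)
Lemma phase_growth z : is_phase z -> exists2 c : R, 0 < c &
  forall x y, x <= y -> c * (y - x) <= z y - z x.
Proof.
move=> [cz C2z]; have [m [M [m0 M0 mM]]] := eigenfunction_bounds.
have s0 : 0 < Num.min 1 sigma by rewrite lt_min ltr01 hsigma.
exists (Num.min 1 sigma / M ^+ 2); first by rewrite divr_gt0// exprn_gt0.
move=> x y xy; rewrite leNgt; apply/negP => zxy.
have {}xy : x < y.
  rewrite lt_neqAle xy andbT; apply/eqP => xyE.
  by move: zxy; rewrite xyE !subrr mulr0 ltxx.
pose c := (z y - z x) / (y - x).
have cE : c * (y - x) = z y - z x by rewrite divfK// subr_eq0 gt_eqF.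
have cc : c < Num.min 1 sigma / M ^+ 2 by rewrite -(ltr_pM2r (x := y - x)) ?subr_gt0// cE.
pose g w := z w - c * w.
have cg : continuous g.
  by move=> w; apply: cvgB; [exact: cz|apply: cvgM; [exact: cvg_cst|exact: cvg_id]].
have [w wxy wmax] := EVT_max (ltW xy) (continuous_subspaceT cg).
have gE : g y = g x by rewrite /g; lra.
have [v vxy vmax] : exists2 v, x <= v < y & forall t, x <= t <= y -> g t <= g v.
  have [wy|wy] := eqVneq w y.
    by exists x; [lra|move=> t txy; rewrite -gE -wy; apply: wmax; rewrite in_itv].
  exists w; last by move=> t txy; apply: wmax; rewrite in_itv.
  by move: wxy; rewrite in_itv /= => /andP[-> wley]; rewrite lt_neqAle wy.
have [i [j [al [bl [ar [br [s [_ [pj xr] _ _]]]]]]]] :=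
  point_sides hl1 hl2 hsigma v.
have [? [? [Cr _]]] := eigenfunction_on_patch hl1 hl2 hphi pj.
have [dz _ [cvz cvz1 _]] := C2_on_right (C2z _ _ _ _ _ pj Cr) xr.
have cl : (fun t => c - k j / phi t ^+ 2) t @[t --> v^'+] --> c - k j / phi v ^+ 2.
  by apply: cvgB; [exact: cvg_cst|exact: cvz1].
have gN : (fun t => - g t) = (fun t => c * t - z t).
  by apply/funext => r; rewrite /g opprB.
have dneg : \forall t \near v^'+, is_derive (t : R) 1 (fun t => - g t) (c - k j / phi t ^+ 2).
  apply: filterS dz => t dzt.
  have := is_derive1B (is_derive1M (is_derive_cst c t 1) (is_derive_id t 1)) dzt.
  by rewrite mul0r add0r mulr1 gN.
have neg : c - k j / phi v ^+ 2 < 0.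
  rewrite subr_lt0 (lt_le_trans cc)//; apply: ler_pM.
  - exact: ltW.
  - by rewrite invr_ge0 exprn_ge0// ltW.
  - by rewrite /slope; case: (j); rewrite ge_min lexx ?orbT.
  - rewrite lef_pV2 ?posrE ?exprn_gt0//.
    by rewrite ler_pXn2r ?nnegrE ?(ltW M0) ?(ltW (phi_pos v))//; case/andP: (mM v).
have cng : - g t @[t --> v^'+] --> - g v.
  by apply: cvgN; apply: cvg_at_right_filter; exact: cg.
have lt1 := right_derivative_lt0 dneg cng cl neg.
have [e e0 He] := (near_rightP _ _).1 lt1.
pose t := Num.min (v + e / 2) y.
have vt : v < t by rewrite lt_min; lra.
have te : t <= v + e / 2 by rewrite ge_min lexx.
have ty : t <= y by rewrite ge_min lexx orbT.
have := He t ltac:(lra); rewrite ltrN2 ltNge vmax//; lra.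
Qed.

Lemma diffusion_bounds : exists a0 a1, [/\ 0 < a0, 0 < a1 &
  forall j x, a0 <= d j * k j ^+ 2 / phi x ^+ 4 <= a1].
Proof.
have [m [M [m0 M0 mM]]] := eigenfunction_bounds.
pose p := d1 * sigma ^+ 2.
have p0 : 0 < p by rewrite mulr_gt0// exprn_gt0.
have dE j : d j * k j ^+ 2 = if j then p else d2.
  by case: j => //; rewrite /= /slope expr1n mulr1.
have q0 : 0 < Num.min p d2 by rewrite lt_min p0 hd2.
have q1 : 0 < Num.max p d2 by rewrite lt_max p0.
exists (Num.min p d2 / M ^+ 4), (Num.max p d2 / m ^+ 4); split.
- by rewrite divr_gt0// exprn_gt0.
- by rewrite divr_gt0// exprn_gt0.
move=> j x; have [mx xM] := andP (mM x); have px := phi_pos x.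
rewrite dE; apply/andP; split; apply: ler_pM.
- exact: ltW.
- by rewrite invr_ge0 exprn_ge0// ltW.
- by case: j; rewrite ge_min lexx ?orbT.
- rewrite lef_pV2 ?posrE ?exprn_gt0//.
  by rewrite ler_pXn2r ?nnegrE// ltW.
- by case: j; exact: ltW.
- by rewrite invr_ge0 exprn_ge0// ltW.
- by case: j; rewrite le_max lexx ?orbT.
- rewrite lef_pV2 ?posrE ?exprn_gt0//.
  by rewrite ler_pXn2r ?nnegrE// ltW.
Qed.

Context (z : R -> R) (hz : is_phase z).

Let growth := phase_growth hz.

Lemma phase_lt x y : z x < z y -> x < y.
Proof.
have [c c0 gr] := growth; move=> zxy; rewrite ltNge; apply/negP => yx.
have cxy : 0 <= c * (x - y) by rewrite mulr_ge0 ?(ltW c0)// subr_ge0.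
by have := gr _ _ yx; lra.
Qed.

Lemma phase_le x y : x <= y -> z x <= z y.
Proof. by move=> xy; rewrite leNgt; apply/negP => /phase_lt; rewrite ltNge xy. Qed.

Lemma phase_increasing x y : x < y -> z x < z y.
Proof.
have [c c0 gr] := growth; move=> xy; rewrite -subr_gt0.
by apply: lt_le_trans (gr _ _ (ltW xy)); rewrite mulr_gt0// subr_gt0.
Qed.

Lemma phase_onto q : exists x, z x = q.
Proof.
have [c c0 gr] := growth.
pose r := (`|q - z 0| + 1) / c.
have r0 : 0 < r by rewrite divr_gt0// ltr_pwDr.
have rE : c * r = `|q - z 0| + 1 by rewrite mulrC divfK// gt_eqF.
have zr : q <= z r.
  have := gr 0 r (ltW r0); rewrite subr0 rE; have := ler_norm (q - z 0); lra.
have zNr : z (- r) <= q.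
  have := gr (- r) 0 ltac:(lra); rewrite sub0r opprK rE.
  by have := ler_norm (- (q - z 0)); rewrite normrN; lra.
have Nrr : - r <= r by lra.
have zz : z (- r) <= z r by exact: phase_le.
have [x _ xE] := IVT Nrr (continuous_subspaceT hz.1)
  (ltac:(by rewrite (min_idPl zz) (max_idPr zz) zNr zr) :
     Num.min (z (- r)) (z r) <= q <= Num.max (z (- r)) (z r)).
by exists x.
Qed.

End Phase.

(** * The reaction terms near zero *)

Lemma KPP_C1 {R : realType} (f : R -> R) K : KPP f K -> is_C1 f /\ f 0 = 0.
Proof. by case=> -[? []]. Qed.

Lemma bistable_C1 {R : realType} (f : R -> R) theta K :
  bistable f theta K -> is_C1 f /\ f 0 = 0.
Proof. by case=> -[? []]. Qed.

Section C1.
Context {R : realType} (f : R -> R).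
Context (f_C1 : is_C1 f).
Context (f00 : f 0 = 0).

Lemma C1_is_derive (x : R) : is_derive x 1 f (derive1 f x).
Proof. by apply: DeriveDef; [exact: f_C1.1|rewrite derive1E]. Qed.

Lemma C1_continuous : continuous f.
Proof. by move=> x; exact: is_derive1_continuous (C1_is_derive x). Qed.

Lemma linear_bound_left (M : R) : exists B : R, forall s, - M <= s <= 0 -> B * s <= f s.
Proof.
have [M0|M0] := leP 0 M; last by exists 0 => s; lra.
have M0' : - M <= 0 by lra.
have [c _ cmax] := EVT_max M0' (continuous_subspaceT f_C1.2).
exists (derive1 f c) => s sM.
have [->|s0] := eqVneq s 0; first by rewrite mulr0 f00.
have {}s0 : s < 0 by rewrite lt_neqAle s0; case/andP: sM.
have [e] := MVT s0 (fun x _ => C1_is_derive x) (continuous_subspaceT C1_continuous).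
rewrite in_itv /= => ese; rewrite f00 !sub0r mulrN => /oppr_inj ->.
by rewrite ler_nM2r// cmax// in_itv /=; lra.
Qed.

Lemma linear_bound_right (beta : R) : 0 < beta -> exists2 s0 : R, 0 < s0 &
  forall s, 0 <= s <= s0 -> (derive1 f 0 - beta) * s <= f s.
Proof.
move=> beta0; have /cvgrPdist_lt /(_ beta beta0) [e /= e0 He] := f_C1.2 0.
exists (e / 2); first by rewrite divr_gt0.
move=> s se; have [->|s0] := eqVneq s 0; first by rewrite mulr0 f00.
have {}s0 : 0 < s by rewrite lt_neqAle eq_sym s0; case/andP: se.
have [c] := MVT s0 (fun x _ => C1_is_derive x) (continuous_subspaceT C1_continuous).
rewrite in_itv /= => cs; rewrite f00 !subr0 => ->.
rewrite ler_pM2r//.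
have := He c; rewrite /= sub0r normrN ger0_norm; last by lra.
by move=> /(_ ltac:(lra)); rewrite ltr_norml; lra.
Qed.

End C1.

(** * Comparison *)

Lemma continuous_time {R : realType} (g : R -> R) :
  continuous g -> continuous (fun p : R * R => g p.1).
Proof.
move=> cg p; apply: (@continuous_comp _ _ _ (fst : R * R -> R) g p).
  by case: p => a b; exact: cvg_fst.
exact: cg.
Qed.

Lemma continuous_space {R : realType} (g : R -> R) :
  continuous g -> continuous (fun p : R * R => g p.2).
Proof.
move=> cg p; apply: (@continuous_comp _ _ _ (snd : R * R -> R) g p).
  by case: p => a b; exact: cvg_snd.
exact: cg.
Qed.

Section Comparison.
Context {R : realType} (l1 l2 d1 d2 sigma : R) (f1 f2 : R -> R).
Context (hl1 : 0 < l1) (hl2 : 0 < l2) (hsigma : 0 < sigma).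
Context (hd1 : 0 < d1) (hd2 : 0 < d2).
Context (f1C : is_C1 f1 /\ f1 0 = 0) (f2C : is_C1 f2 /\ f2 0 = 0).
Context (lambda : R) (phi : R -> R).
Context (hphi : principal_eigenfunction l1 l2 d1 d2 sigma f1 f2 lambda phi).
Context (z : R -> R) (hz : is_phase l1 l2 sigma phi z).
Context (u0 : R -> R) (u : R -> R -> R).
Context (hu : patch_solution l1 l2 d1 d2 sigma f1 f2 u0 u).

Local Notation d := (dpatch d1 d2).
Local Notation f := (fpatch f1 f2).
Local Notation k := (slope sigma).

Let phi_pos x : 0 < phi x. Proof. exact: phi_gt0 hphi x. Qed.
Let phi_cont : continuous phi. Proof. by case: hphi => -[]. Qed.
Let z_cont : continuous z. Proof. by case: hz. Qed.
Let f_C1 j : is_C1 (f j) /\ f j 0 = 0. Proof. by case: j. Qed.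
Let f_cont j : continuous (f j). Proof. exact: C1_continuous (f_C1 j).1. Qed.

(** The minimum of [e^(-K t) (u / phi - chi(t, z))] over the rectangle is attained
    by compactness. If it were a number [m < 0], then [chi + m e^(K t)] would
    touch [u / phi] from below at a point that is neither initial nor lateral,
    and [strict] forbids this. The exponential weight replaces the Lipschitz
    argument for the nonlinearity: [strict] is only tested at values [v < chi]. *)
Lemma comparison (chi chit chiz chizz : R -> R -> R) (K t0 T x1 x2 : R) :
  (forall t w : R, is_derive t 1 (chi^~ w) (chit t w)) ->
  (forall t w : R, is_derive w 1 (chi t) (chiz t w)) ->
  (forall t w : R, is_derive w 1 (chiz t) (chizz t w)) ->
  (forall t : R, continuous (chizz t)) ->
  continuous (fun p : R * R => chi p.1 p.2 : R) ->
  0 <= t0 ->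
  (forall x, x1 <= x <= x2 -> phi x * chi t0 (z x) <= u t0 x) ->
  (forall t, t0 <= t <= T -> phi x1 * chi t (z x1) <= u t x1) ->
  (forall t, t0 <= t <= T -> phi x2 * chi t (z x2) <= u t x2) ->
  (forall j t x v, t0 < t <= T -> x1 < x < x2 -> v < chi t (z x) ->
     u t x = phi x * v ->
     phi x * (chit t (z x) + K * (v - chi t (z x))) <
     d j * k j ^+ 2 / phi x ^+ 3 * chizz t (z x)
     - (derive1 (f j) 0 + lambda) * (phi x * v) + f j (phi x * v)) ->
  forall t x, t0 <= t <= T -> x1 <= x <= x2 -> phi x * chi t (z x) <= u t x.
Proof.
move=> dt dz dzz czz cchi t0_ge0 init lat1 lat2 strict t x tT x12.
pose w (p : R * R) := expR (- K * p.1) * (u p.1 p.2 / phi p.2 - chi p.1 (z p.2)).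
pose A := [set` `[t0, T]] `*` [set` `[x1, x2]] : set (R * R).
have Atx : A (t, x) by split; rewrite /= in_itv.
have cA : compact A by apply: compact_setX; exact: segment_compact.
have cw : {within A, continuous w}.
  have cu : {within A, continuous (fun p : R * R => u p.1 p.2 : R)}.
    case: hu => cu _ _ _ _; apply: continuous_subspaceW cu => -[s y] [/=].
    by rewrite in_itv /= => /andP[st0 _] _; exact: le_trans st0.
  have cp : continuous (fun y => (phi y)^-1).
    by move=> y; apply: cvgV; [rewrite gt_eqF|exact: phi_cont].
  have cz : continuous (fun p : R * R => chi p.1 (z p.2)).
    move=> p; apply: (@continuous_comp _ _ _ (fun p : R * R => (p.1, z p.2))
        (fun p : R * R => chi p.1 p.2) p); last exact: cchi.
    have cid : continuous (fun y : R => y) by move=> y; exact: cvg_id.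
    have h1 : q.1 @[q --> p] --> p.1 by exact: (continuous_time cid).
    have h2 : z q.2 @[q --> p] --> z p.2 by exact: (continuous_space z_cont).
    exact: (cvg_pair h1 h2).
  apply/subspace_continuousP => p Ap.
  have cup := (subspace_continuousP _ _).1 cu p Ap.
  have win (g : R * R -> R) : continuous g -> g @ within A (nbhs p) --> g p.
    by move=> cg; apply: cvg_within_filter; exact: cg.
  have ct : continuous (fun p : R * R => expR (- K * p.1)).
    exact: (continuous_time (@continuous_expRM R (- K))).
  have cx : continuous (fun p : R * R => (phi p.2)^-1).
    exact: (continuous_space cp).
  exact: (cvgM (win _ ct) (cvgB (cvgM cup (win _ cx)) (win _ cz))).
have [[ts xs] /set_mem [/= tsT xs12] wmin] := compact_EVT_min (ex_intro _ _ Atx) cA cw.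
have {}wmin s y : t0 <= s <= T -> x1 <= y <= x2 -> w (ts, xs) <= w (s, y).
  by move=> sT y12; apply: wmin; apply/mem_set; split; rewrite /= in_itv.
move: tsT xs12; rewrite !in_itv /= => tsT xs12.
have wge0 s y : (0 <= w (s, y)) = (phi y * chi s (z y) <= u s y).
  by rewrite /w /= pmulr_rge0 ?expR_gt0// subr_ge0 ler_pdivlMr// mulrC.
rewrite -wge0; apply: le_trans (wmin _ _ tT x12).
rewrite leNgt; apply/negP => wneg.
have ts0 : ts != t0.
  by apply: contraTneq wneg => tsE; rewrite -leNgt wge0 tsE init.
have xs1 : xs != x1.
  by apply: contraTneq wneg => xsE; rewrite -leNgt wge0 xsE lat1.
have xs2 : xs != x2.
  by apply: contraTneq wneg => xsE; rewrite -leNgt wge0 xsE lat2.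
have {}ts0 : t0 < ts by rewrite lt_neqAle eq_sym ts0; case/andP: tsT.
have {}xs12 : x1 < xs < x2.
  by rewrite !lt_neqAle xs2 eq_sym xs1; move: xs12 => /andP[-> ->].
pose m := w (ts, xs).
pose C s := m * expR (K * s).
have dC (s : R) : is_derive s 1 C (m * (K * expR (K * s))).
  have := is_derive1M (is_derive_cst m s 1) (is_derive_expRM K s).
  by move=> /is_derive_eq; apply; rewrite /cst /=; ring.
have wC s y : t0 <= s <= T -> x1 <= y <= x2 ->
    phi y * (chi s (z y) + C s) <= u s y.
  move=> sT y12; have := wmin s y sT y12; rewrite -/m /w /= mulNr expRN [leRHS]mulrC.
  by rewrite ler_pdivlMr ?expR_gt0// -/(C s) lerBrDl ler_pdivlMr// mulrC.
have uE : u ts xs = phi xs * (chi ts (z xs) + C ts).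
  rewrite /C /m /w /= mulNr expRN.
  by field; rewrite (gt_eqF (phi_pos _)) (gt_eqF (expR_gt0 _)).
have dX (s y : R) : is_derive y 1 (fun y => chi s y + C ts) (chiz s y).
  by have := is_derive1D (dz s y) (is_derive_cst (C ts) y 1); rewrite addr0.
have [|||j] := @touching_from_below R l1 l2 d1 d2 sigma f1 f2 hl1 hl2 hsigma hd1
   hd2 lambda phi hphi f_cont z hz u0 u hu (fun y => chi ts y + C ts) (chiz ts)
   (chizz ts) (fun s => chi s (z xs) + C s) _ t0 ts xs (dX ts) (dzz ts) (czz ts)
   _ (is_derive1D (dt ts (z xs)) (dC ts)) erefl uE.
- by rewrite t0_ge0.
- by apply: filterS (near_in xs12) => y y12; apply: wC; lra.
- by move=> s sts; apply: wC; lra.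
apply/negP; rewrite -ltNge.
have Cneg : C ts < 0 by rewrite /C nmulr_rlt0// expR_gt0.
have := strict j ts xs (chi ts (z xs) + C ts) ltac:(lra) xs12 ltac:(lra) uE.
have -> : chi ts (z xs) + C ts - chi ts (z xs) = C ts by ring.
by rewrite /C mulrCA.
Qed.

End Comparison.

(** * Nonnegativity of the solution *)

Section Nonnegativity.
Context {R : realType} (l1 l2 d1 d2 sigma : R) (f1 f2 : R -> R).
Context (hl1 : 0 < l1) (hl2 : 0 < l2) (hsigma : 0 < sigma).
Context (hd1 : 0 < d1) (hd2 : 0 < d2).
Context (f1C : is_C1 f1 /\ f1 0 = 0) (f2C : is_C1 f2 /\ f2 0 = 0).
Context (lambda : R) (phi : R -> R).
Context (hphi : principal_eigenfunction l1 l2 d1 d2 sigma f1 f2 lambda phi).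
Context (z : R -> R) (hz : is_phase l1 l2 sigma phi z).
Context (u0 : R -> R) (u : R -> R -> R).
Context (hu : patch_solution l1 l2 d1 d2 sigma f1 f2 u0 u).

Local Notation d := (dpatch d1 d2).
Local Notation f := (fpatch f1 f2).
Local Notation k := (slope sigma).

Let phi_pos x : 0 < phi x. Proof. exact: phi_gt0 hphi x. Qed.
Let f_C1 j : is_C1 (f j) /\ f j 0 = 0. Proof. by case: j. Qed.
Let compar := comparison hl1 hl2 hsigma hd1 hd2 f1C f2C hphi hz hu.
Let onto := phase_onto hl1 hl2 hsigma hphi hz.
Let zlt := phase_lt hl1 hl2 hsigma hphi hz.

(** A Phragmen-Lindelof argument: [u] is bounded on bounded time intervals, hence
    lies above the barrier [- eps e^(K t) (1 + z^2) phi] wherever [|z|] is large,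
    and comparison extends this to all [x]. Then [eps] tends to 0. *)
Lemma solution_ge0 : (forall x, 0 <= u0 x) -> forall t x, 0 <= t -> 0 <= u t x.
Proof.
move=> u0_ge0 t x t0.
have [m [M [m0 M0 mM]]] := eigenfunction_bounds hl1 hl2 hphi.
have [a0 [a1 [a0_gt0 a1_gt0 a01]]] :=
  diffusion_bounds hl1 hl2 hsigma hd1 hd2 hphi.
have T0 : 0 < t + 1 by lra.
have [N uN] : exists N : R, forall s y, 0 <= s <= t + 1 -> `|u s y| <= N.
  by case: hu => _ /(_ _ T0) [N uN] _ _ _; exists N.
have N0 : 0 <= N by apply: (le_trans (normr_ge0 (u 0 0))); apply: uN; lra.
have lip j : exists B : R, forall s, - N <= s <= 0 -> B * s <= f j s.
  by have [fC f0] := f_C1 j; exact: linear_bound_left.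
have [B1 hB1] := lip true; have [B2 hB2] := lip false.
pose B j := if j then B1 else B2.
have hB j s : - N <= s <= 0 -> B j * s <= f j s by case: j; [exact: hB1|exact: hB2].
pose Q j := B j - derive1 (f j) 0 - lambda.
pose K := 2 * a1 + 1 + (`|Q true| + `|Q false|).
have K0 : 0 <= K by rewrite /K; have := normr_ge0 (Q true); have := normr_ge0 (Q false); lra.
have KQ j : 2 * a1 + 1 <= K - Q j.
  have := ler_norm (Q true); have := ler_norm (Q false).
  have := normr_ge0 (Q true); have := normr_ge0 (Q false).
  by rewrite /K; case: j; lra.
have main (eps : R) : 0 < eps -> phi x * (- eps * expR (K * t) * (1 + z x ^+ 2)) <= u t x.
  move=> eps0.
  (* The lateral walls z = - q and z = q lie beyond the point x, and there the
     barrier is below - N. *)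
  pose q := N / (m * eps) + `|z x| + 1.
  have Nq : 0 <= N / (m * eps) by rewrite divr_ge0// mulr_ge0// ltW.
  have qN : N <= m * (eps * q).
    have me : 0 < m * eps by rewrite mulr_gt0.
    rewrite mulrA mulrC -ler_pdivrMr// /q; have := normr_ge0 (z x); lra.
  have q1 : 1 <= q by have := normr_ge0 (z x); rewrite /q; lra.
  have qz : `|z x| < q by rewrite /q; lra.
  have [x2 x2E] := onto q; have [x1 x1E] := onto (- q).
  have x1x : x1 < x by apply: zlt; rewrite x1E; move: qz; rewrite ltr_norml; lra.
  have xx2 : x < x2 by apply: zlt; rewrite x2E; move: qz; rewrite ltr_norml; lra.
  have lat s y : 0 <= s <= t + 1 -> z y ^+ 2 = q ^+ 2 ->
      phi y * (- eps * expR (K * s) * (1 + z y ^+ 2)) <= u s y.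
    move=> st zq; have := uN s y st; rewrite ler_norml => /andP[Nu _].
    apply: le_trans Nu; rewrite !mulNr mulrN lerN2 (le_trans qN)// zq.
    apply: ler_pM; [exact: ltW|by rewrite mulr_ge0; lra|by case/andP: (mM y)|].
    rewrite -mulrA ler_pM2l//.
    have e1 : 1 <= expR (K * s) by rewrite -expR0 ler_expR mulr_ge0//; lra.
    have qq : q <= 1 + q ^+ 2 by have := sqr_ge0 (q - 1); nra.
    by rewrite -[leLHS]mul1r ler_pM//; lra.
  apply: (@compar (fun t w => - eps * expR (K * t) * (1 + w ^+ 2))
    (fun t w => - eps * (K * expR (K * t)) * (1 + w ^+ 2))
    (fun t w => - eps * expR (K * t) * (2 * w))
    (fun t w => - eps * expR (K * t) * 2) K 0 (t + 1) x1 x2).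
  - move=> s w; have := is_derive1M (is_derive1M (is_derive_cst (- eps : R) s 1)
      (is_derive_expRM K s)) (is_derive_cst (1 + w ^+ 2 : R) s 1).
    by move=> /is_derive_eq; apply; rewrite /cst /=; ring.
  - move=> s w; have := is_derive1M (is_derive_cst (- eps * expR (K * s) : R) w 1)
      (is_derive1D (is_derive_cst (1 : R) w 1)
        (is_derive1M (is_derive_id w 1) (is_derive_id w 1))).
    by move=> /is_derive_eq; apply; rewrite /cst /=; ring.
  - move=> s w; have := is_derive1M (is_derive_cst (- eps * expR (K * s) : R) w 1)
      (is_derive1M (is_derive_cst (2 : R) w 1) (is_derive_id w 1)).
    by move=> /is_derive_eq; apply; rewrite /cst /=; ring.
  - by move=> s w; exact: cvg_cst.
  - move=> p; apply: cvgM.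
      apply: cvgM; first exact: cvg_cst.
      exact: (continuous_time (@continuous_expRM R K)).
    apply: cvgD; first exact: cvg_cst.
    have cid : continuous (fun y : R => y) by move=> y; exact: cvg_id.
    by apply: cvgM; exact: (continuous_space cid).
  - exact: lexx.
  - move=> y _; have -> : u 0 y = u0 y by case: hu => _ _ ->.
    apply: le_trans (u0_ge0 y); rewrite !mulNr mulrN oppr_le0.
    by rewrite !mulr_ge0 ?expR_ge0 ?addr_ge0 ?sqr_ge0//; exact: ltW.
  - by move=> s st; apply: lat => //; rewrite x1E sqrrN.
  - by move=> s st; apply: lat => //; rewrite x2E.
  - move=> j s y v st y12 vlt uE.
    have px := phi_pos y.
    set E := expR (K * s) in vlt *.
    have E0 : 0 < E by exact: expR_gt0.
    have vE : v < - (eps * E).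
      apply: lt_le_trans vlt _; rewrite mulNr mulNr lerN2 -[leLHS]mulr1.
      by rewrite ler_pM2l ?mulr_gt0// lerDl sqr_ge0.
    have eE : 0 < eps * E by rewrite mulr_gt0.
    have pv : phi y * v < - (phi y * (eps * E)) by rewrite -mulrN ltr_pM2l.
    have pE : 0 < phi y * (eps * E) by rewrite mulr_gt0.
    have fv : B j * (phi y * v) <= f j (phi y * v).
      apply: hB; rewrite -uE.
      have : `|u s y| <= N by apply: uN; lra.
      by rewrite ler_norml uE; lra.
    have aE : d j * k j ^+ 2 / phi y ^+ 3 * (- eps * E * 2)
       = - (2 * (d j * k j ^+ 2 / phi y ^+ 4) * (phi y * (eps * E))).
      by field; rewrite gt_eqF.
    have ale : 2 * (d j * k j ^+ 2 / phi y ^+ 4) * (phi y * (eps * E)) <=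
        2 * a1 * (phi y * (eps * E)).
      by rewrite ler_pM2r// ler_pM2l//; case/andP: (a01 j y).
    have KQv : (K - Q j) * (phi y * v) <= (2 * a1 + 1) * (phi y * v).
      by rewrite ler_wnM2r//; lra.
    have Kv : (2 * a1 + 1) * (phi y * v) < (2 * a1 + 1) * - (phi y * (eps * E)).
      by rewrite ltr_pM2l//; lra.
    have -> : phi y * (- eps * (K * E) * (1 + z y ^+ 2) +
       K * (v - - eps * E * (1 + z y ^+ 2))) = K * (phi y * v) by ring.
    rewrite aE; rewrite /Q in KQv.
    by lra.
  - by lra.
  - by rewrite !ltW.
rewrite leNgt; apply/negP => uneg.
pose A := phi x * (expR (K * t) * (1 + z x ^+ 2)).
have A0 : 0 < A by rewrite !mulr_gt0 ?expR_gt0// ltr_pwDl// sqr_ge0.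
have := main (- u t x / (2 * A)) ltac:(by rewrite divr_gt0 ?oppr_gt0// mulr_gt0).
have -> : phi x * (- (- u t x / (2 * A)) * expR (K * t) * (1 + z x ^+ 2))
   = (u t x / (2 * A)) * A by rewrite /A; ring.
have -> : (u t x / (2 * A)) * A = u t x / 2 by field; rewrite gt_eqF.
by lra.
Qed.

End Nonnegativity.

(** * Barriers and spreading *)

Section Spreading.
Context {R : realType} (l1 l2 d1 d2 sigma : R) (f1 f2 : R -> R).
Context (hl1 : 0 < l1) (hl2 : 0 < l2) (hsigma : 0 < sigma).
Context (hd1 : 0 < d1) (hd2 : 0 < d2).
Context (f1C : is_C1 f1 /\ f1 0 = 0) (f2C : is_C1 f2 /\ f2 0 = 0).
Context (lambda : R) (phi : R -> R).
Context (hphi : principal_eigenfunction l1 l2 d1 d2 sigma f1 f2 lambda phi).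
Context (z : R -> R) (hz : is_phase l1 l2 sigma phi z).
Context (u0 : R -> R) (u : R -> R -> R).
Context (hu : patch_solution l1 l2 d1 d2 sigma f1 f2 u0 u).
Context (u_ge0 : forall t x, 0 <= t -> 0 <= u t x).

Local Notation d := (dpatch d1 d2).
Local Notation f := (fpatch f1 f2).
Local Notation k := (slope sigma).

Context (a0 a1 b eta0 : R) (a0_gt0 : 0 < a0).
Context (ha : forall j x, a0 <= d j * k j ^+ 2 / phi x ^+ 4 <= a1).
Context (hgrow : forall j x v, 0 <= v <= eta0 -> b * (phi x * v) <=
  f j (phi x * v) - (derive1 (f j) 0 + lambda) * (phi x * v)).

Let phi_pos x : 0 < phi x. Proof. exact: phi_gt0 hphi x. Qed.
Let compar := comparison hl1 hl2 hsigma hd1 hd2 f1C f2C hphi hz hu.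
Let onto := phase_onto hl1 hl2 hsigma hphi hz.
Let zinc := phase_increasing hl1 hl2 hsigma hphi hz.
Let zlt := phase_lt hl1 hl2 hsigma hphi hz.
Let zle := phase_le hl1 hl2 hsigma hphi hz.

(** In the variables [v = u / phi] and [z] the equation for a small positive [v]
    reads [v_t >= a v_zz + b v] with a coefficient [a] between [a0] and [a1]; only
    these bounds are kept. *)
Lemma barrier_comparison (chi chit chiz chizz : R -> R -> R) (K t0 T x1 x2 : R) :
  (forall t w : R, is_derive t 1 (chi^~ w) (chit t w)) ->
  (forall t w : R, is_derive w 1 (chi t) (chiz t w)) ->
  (forall t w : R, is_derive w 1 (chiz t) (chizz t w)) ->
  (forall t : R, continuous (chizz t)) ->
  continuous (fun p : R * R => chi p.1 p.2 : R) ->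
  0 <= t0 ->
  (forall x, x1 <= x <= x2 -> phi x * chi t0 (z x) <= u t0 x) ->
  (forall t, t0 <= t <= T -> phi x1 * chi t (z x1) <= u t x1) ->
  (forall t, t0 <= t <= T -> phi x2 * chi t (z x2) <= u t x2) ->
  (forall t x, t0 <= t <= T -> x1 <= x <= x2 -> chi t (z x) <= eta0) ->
  (forall a t x v, a0 <= a <= a1 -> t0 < t <= T -> x1 < x < x2 ->
     0 <= v < chi t (z x) ->
     chit t (z x) + K * (v - chi t (z x)) < a * chizz t (z x) + b * v) ->
  forall t x, t0 <= t <= T -> x1 <= x <= x2 -> phi x * chi t (z x) <= u t x.
Proof.
move=> dt dz dzz czz cchi t0_ge0 init lat1 lat2 small strict.
apply: (compar dt dz dzz czz cchi t0_ge0 init lat1 lat2).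
move=> j t x v tT x12 vlt uE; have px := phi_pos x.
have v_ge0 : 0 <= v.
  by rewrite -(pmulr_rge0 v px) -uE; apply: u_ge0; lra.
have chi_le : chi t (z x) <= eta0 by apply: small; lra.
have g : b * (phi x * v) <=
    f j (phi x * v) - (derive1 (f j) 0 + lambda) * (phi x * v).
  by apply: hgrow; lra.
have := strict _ t x v (ha j x) tT x12 ltac:(by rewrite v_ge0).
rewrite -(ltr_pM2l px).
have -> : phi x * (d j * k j ^+ 2 / phi x ^+ 4 * chizz t (z x) + b * v)
  = d j * k j ^+ 2 / phi x ^+ 3 * chizz t (z x) + b * (phi x * v).
  by field; rewrite gt_eqF.
by move=> /lt_le_trans; apply; lra.
Qed.

(** Diffusion erodes the cosine at a rate of at most [eps^2 a1], which growth at
    the rate [b] and decay at the rate [kappa] compensate together. *)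
Lemma cos_barrier (eta eps kappa t0 T x1 x2 : R) :
  0 <= eta <= eta0 -> 0 <= kappa -> eps ^+ 2 * a1 <= b + kappa -> 0 <= b ->
  0 <= t0 -> forall w0,
  cos (eps * (z x1 - w0)) <= 0 -> cos (eps * (z x2 - w0)) <= 0 ->
  (forall x, x1 <= x <= x2 -> phi x * (eta * cos (eps * (z x - w0))) <= u t0 x) ->
  forall t x, t0 <= t <= T -> x1 <= x <= x2 ->
    phi x * (eta * expR (- kappa * (t - t0)) * cos (eps * (z x - w0))) <= u t x.
Proof.
move=> eta01 kappa0 epsE b_ge0 t0_ge0 w0 cos1 cos2 init.
pose E (t : R) := expR (- kappa * (t - t0)).
have dE (t : R) : is_derive t 1 E (- kappa * E t).
  exact: is_derive_expR_affine.
have darg (w : R) : is_derive w 1 (fun w => eps * (w - w0)) eps.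
  have := is_derive1M (is_derive_cst eps w 1) (is_derive1_shift w0 w).
  by rewrite mul0r add0r mulr1.
have dcos (w : R) : is_derive w 1 (fun w => cos (eps * (w - w0)))
    (- sin (eps * (w - w0)) * eps).
  exact: (@is_derive1_chain R cos (fun w => eps * (w - w0)) w _ _ (is_derive_cos _) (darg w)).
have dsin (w : R) : is_derive w 1 (fun w => sin (eps * (w - w0)))
    (cos (eps * (w - w0)) * eps).
  exact: (@is_derive1_chain R sin (fun w => eps * (w - w0)) w _ _ (is_derive_sin _) (darg w)).
have ccos : continuous (fun w => cos (eps * (w - w0))).
  by move=> w; exact: is_derive1_continuous (dcos w).
have cE : continuous E by move=> t; exact: is_derive1_continuous (dE t).
have E_ge0 t : 0 <= E t by exact: expR_ge0.
have [eta_ge0 eta_le] := andP eta01.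
apply: (@barrier_comparison (fun t w => eta * E t * cos (eps * (w - w0)))
  (fun t w => eta * (- kappa * E t) * cos (eps * (w - w0)))
  (fun t w => eta * E t * (- eps * sin (eps * (w - w0))))
  (fun t w => eta * E t * (- eps ^+ 2 * cos (eps * (w - w0)))) (b + 1) t0 T x1 x2).
- move=> t w; have := is_derive1M (is_derive1M (is_derive_cst (eta : R) t 1) (dE t))
    (is_derive_cst (cos (eps * (w - w0)) : R) t 1).
  by move=> /is_derive_eq; apply; rewrite /cst /=; ring.
- move=> t w; have := is_derive1M (is_derive_cst (eta * E t : R) w 1) (dcos w).
  by move=> /is_derive_eq; apply; rewrite /cst /=; ring.
- move=> t w; have := is_derive1M (is_derive_cst (eta * E t : R) w 1)
    (is_derive1M (is_derive_cst (- eps : R) w 1) (dsin w)).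
  by move=> /is_derive_eq; apply; rewrite /cst /=; ring.
- move=> t w; apply: cvgM; first exact: cvg_cst.
  by apply: cvgM; [exact: cvg_cst|exact: ccos].
- move=> p; apply: cvgM; last exact: (continuous_space ccos).
  by apply: cvgM; [exact: cvg_cst|exact: (continuous_time cE)].
- exact: t0_ge0.
- by move=> x x12; rewrite /E subrr mulr0 expR0 mulr1; exact: init.
- move=> t tT; apply: (@le_trans _ _ 0); last by apply: u_ge0; lra.
  apply: mulr_ge0_le0; first exact: ltW.
  by apply: mulr_ge0_le0 => //; exact: mulr_ge0.
- move=> t tT; apply: (@le_trans _ _ 0); last by apply: u_ge0; lra.
  apply: mulr_ge0_le0; first exact: ltW.
  by apply: mulr_ge0_le0 => //; exact: mulr_ge0.
- move=> t x tT _; apply: le_trans eta_le.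
  have E1 : E t <= 1.
    by rewrite -expR0 ler_expR mulNr oppr_le0 mulr_ge0//; lra.
  have h : eta * E t <= eta by rewrite ler_piMr.
  apply: le_trans h; rewrite ler_piMr ?mulr_ge0//; exact: cos_le1.
- move=> a t x v a01 tT x12 /andP[v0].
  set c := cos _; set e := E t; move=> vlt.
  have ec : 0 <= eta * e * c by lra.
  have h : (eps ^+ 2 * a) * (eta * e * c) <= (b + kappa) * (eta * e * c).
    apply: ler_wpM2r => //; apply: le_trans epsE.
    by rewrite ler_wpM2l ?sqr_ge0//; lra.
  have -> : eta * (- kappa * e) * c = - kappa * (eta * e * c) by ring.
  have -> : a * (eta * e * (- eps ^+ 2 * c)) = - (eps ^+ 2 * a) * (eta * e * c) by ring.
  move: (eta * e * c) vlt ec h => y vlt ec h.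
  by lra.
Qed.

(** The cosine barrier on one half-period centred at [x0], where it vanishes at
    both ends. A narrow bump is allowed to decay at the rate [kappa]; a bump wide
    enough for [a1 (pi / 2 D)^2 <= b] needs no decay, because growth at the rate
    [b] outweighs diffusion. *)
Lemma bump_barrier (eta D kappa t0 T x0 : R) :
  0 <= eta <= eta0 -> 0 < D -> 0 <= kappa ->
  (pi / 2 / D) ^+ 2 * a1 <= b + kappa -> 0 <= b -> 0 <= t0 ->
  (forall x, `|z x - z x0| <= D -> phi x * eta <= u t0 x) ->
  forall t, t0 <= t <= T ->
    phi x0 * (eta * expR (- kappa * (t - t0))) <= u t x0.
Proof.
move=> eta01 D0 kappa0 epsE b_ge0 t0_ge0 bump t tT.
have [eta_ge0 _] := andP eta01.
pose eps : R := pi / 2 / D.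
have epsD : eps * D = pi / 2 by rewrite divfK// gt_eqF.
have [x1 x1E] := onto (z x0 - D); have [x2 x2E] := onto (z x0 + D).
have x10 : x1 < x0 by apply: zlt; lra.
have x02 : x0 < x2 by apply: zlt; lra.
have cx1 : cos (eps * (z x1 - z x0)) <= 0.
  by rewrite x1E addrAC subrr sub0r mulrN cosN epsD cos_pihalf.
have cx2 : cos (eps * (z x2 - z x0)) <= 0.
  by rewrite x2E addrAC subrr add0r epsD cos_pihalf.
have init x : x1 <= x <= x2 ->
    phi x * (eta * cos (eps * (z x - z x0))) <= u t0 x.
  move=> /andP[xx1 xx2]; apply: (@le_trans _ _ (phi x * eta)).
    by rewrite ler_pM2l// ler_piMr ?cos_le1.
  apply: bump; have := zle xx1; have := zle xx2.
  by rewrite x1E x2E ler_norml; lra.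
have := cos_barrier eta01 kappa0 epsE b_ge0 t0_ge0 cx1 cx2 init tT
  (ltac:(lra) : x1 <= x0 <= x2).
by rewrite subrr mulr0 cos0 mulr1.
Qed.

(** Since [a >= a0] and the spatial part is convex, [e^(-nu w)] diffuses at least as
    fast as [e^(-nu^2 a0 t)] decays wherever the former is the larger one, that
    is, wherever the barrier is positive. *)
Lemma exp_barrier (eta nu t0 T x0 x1 x2 : R) :
  0 <= eta <= eta0 -> 0 <= b -> 0 <= t0 ->
  (forall x, x1 <= x <= x2 -> 0 <= nu * (z x - z x0)) ->
  let chi t w := eta * (expR (- nu * (w - z x0)) - expR (- (nu ^+ 2 * a0) * (t - t0))) in
  (forall t, t0 <= t <= T -> phi x1 * chi t (z x1) <= u t x1) ->
  (forall t, t0 <= t <= T -> phi x2 * chi t (z x2) <= u t x2) ->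
  forall t x, t0 <= t <= T -> x1 <= x <= x2 -> phi x * chi t (z x) <= u t x.
Proof.
move=> eta01 b_ge0 t0_ge0 znu chi lat1 lat2.
pose F (t : R) := expR (- (nu ^+ 2 * a0) * (t - t0)).
pose E (w : R) := expR (- nu * (w - z x0)).
have dF (t : R) : is_derive t 1 F (- (nu ^+ 2 * a0) * F t).
  exact: is_derive_expR_affine.
have dE (w : R) : is_derive w 1 E (- nu * E w) by exact: is_derive_expR_affine.
have cF : continuous F by move=> t; exact: is_derive1_continuous (dF t).
have cE : continuous E by move=> t; exact: is_derive1_continuous (dE t).
have [eta_ge0 eta_le] := andP eta01.
have E1 x : x1 <= x <= x2 -> E (z x) <= 1.
  by move=> x12; rewrite -expR0 ler_expR mulNr oppr_le0; exact: znu.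
apply: (@barrier_comparison chi (fun t w => eta * (nu ^+ 2 * a0 * F t))
  (fun t w => eta * (- nu * E w)) (fun t w => eta * (nu ^+ 2 * E w)) 1 t0 T x1 x2) => //.
- move=> t w; have := is_derive1M (is_derive_cst (eta : R) t 1)
    (is_derive1B (is_derive_cst (E w : R) t 1) (dF t)).
  by move=> /is_derive_eq; apply; rewrite /cst /=; ring.
- move=> t w; have := is_derive1M (is_derive_cst (eta : R) w 1)
    (is_derive1B (dE w) (is_derive_cst (F t : R) w 1)).
  by move=> /is_derive_eq; apply; rewrite /cst /=; ring.
- move=> t w; have := is_derive1M (is_derive_cst (eta : R) w 1)
    (is_derive1M (is_derive_cst (- nu : R) w 1) (dE w)).
  by move=> /is_derive_eq; apply; rewrite /cst /=; ring.
- move=> t w; apply: cvgM; first exact: cvg_cst.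
  by apply: cvgM; [exact: cvg_cst|exact: cE].
- move=> p; apply: cvgM; first exact: cvg_cst.
  by apply: cvgB; [exact: (continuous_space cE)|exact: (continuous_time cF)].
- move=> x x12; apply: (@le_trans _ _ 0); last by apply: u_ge0; lra.
  apply: mulr_ge0_le0; first exact: ltW.
  apply: mulr_ge0_le0 => //; rewrite subr_le0 subrr mulr0 expR0.
  exact: E1.
- move=> t x tT x12; apply: le_trans eta_le.
  rewrite ler_piMr// -/(E (z x)) -/(F t).
  by have := E1 _ x12; have : 0 <= F t := expR_ge0 _; lra.
- move=> a t x v a01 tT x12 /andP[v0]; rewrite /chi -/(E (z x)) -/(F t).
  set e := E _; set g := F t; move=> vlt.
  have eta_gt0 : 0 < eta.
    by rewrite lt_neqAle eta_ge0 andbT; apply: contraTneq vlt => <-; rewrite mul0r -leNgt.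
  have ge_ : g <= e.
    by rewrite -subr_ge0 -(pmulr_rge0 _ eta_gt0); lra.
  have h : eta * (nu ^+ 2 * a0 * g) <= a * (eta * (nu ^+ 2 * e)).
    rewrite (mulrCA a) ler_pM2l// (mulrCA a) -mulrA ler_wpM2l ?sqr_ge0//.
    by apply: ler_pM => //; [exact: ltW|exact: expR_ge0|lra].
  have bv : 0 <= b * v by rewrite mulr_ge0.
  by lra.
Qed.

(** A value held at one point for a while invades the line: the barrier starts
    from zero, and its front, where both exponentials agree, moves at the speed
    [mu a0] away from [x0] on either side. *)
Lemma spreading (eta mu t0 T x0 : R) :
  0 <= eta <= eta0 -> 0 <= b -> 0 <= t0 -> 0 < mu ->
  (forall t, t0 <= t <= T -> phi x0 * eta <= u t x0) ->
  forall t x, t0 <= t <= T ->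
    phi x * (eta * (expR (- mu * `|z x - z x0|)
                    - expR (- (mu ^+ 2 * a0) * (t - t0)))) <= u t x.
Proof.
move=> eta01 b_ge0 t0_ge0 mu0 ux0 t x tT; have [eta_ge0 _] := andP eta01.
have at0 nu s : t0 <= s <= T ->
    phi x0 * (eta * (expR (- nu * (z x0 - z x0)) - expR (- (nu ^+ 2 * a0) * (s - t0)))) <= u s x0.
  move=> sT; apply: le_trans (ux0 s sT); rewrite subrr mulr0 expR0.
  rewrite ler_pM2l// ler_piMr// lerBlDr lerDl; exact: expR_ge0.
have far nu s y : t0 <= s <= T -> mu ^+ 2 * a0 * (T - t0) <= nu * (z y - z x0) ->
    nu ^+ 2 = mu ^+ 2 ->
    phi y * (eta * (expR (- nu * (z y - z x0)) - expR (- (nu ^+ 2 * a0) * (s - t0)))) <= u s y.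
  move=> sT nuy nuE; apply: (@le_trans _ _ 0); last by apply: u_ge0; lra.
  rewrite mulr_ge0_le0 ?(ltW (phi_pos _))// mulr_ge0_le0// subr_le0 ler_expR.
  rewrite !mulNr lerN2; apply: le_trans nuy; rewrite nuE ler_wpM2l//; last by lra.
  by rewrite mulr_ge0 ?sqr_ge0// ltW.
(* The front has not reached the phase z x0 + q, resp. z x0 - q, at time T. *)
pose q := mu * a0 * (T - t0) + `|z x - z x0|.
have qE : mu * q = mu ^+ 2 * a0 * (T - t0) + mu * `|z x - z x0| by rewrite /q; ring.
have q_ge : `|z x - z x0| <= q.
  by rewrite /q lerDr mulr_ge0 ?mulr_ge0 ?(ltW mu0) ?(ltW a0_gt0)//; lra.
have munz : 0 <= mu * `|z x - z x0| by rewrite mulr_ge0// ltW.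
have [x0x|xx0] := leP x0 x.
  have [y yE] := onto (z x0 + q).
  have zx0x : z x0 <= z x by exact: zle.
  have := q_ge; rewrite ger0_norm ?subr_ge0// => q_ge'.
  have [x'x|xx'] := leP x y; last first.
    have yx : z y <= z x by apply: zle; exact: ltW.
    have zyx : z x = z y by lra.
    have := far mu t x tT; rewrite zyx yE; have -> : z x0 + q - z x0 = q by ring.
    by apply; rewrite ?qE; lra.
  apply: (@exp_barrier eta mu t0 T x0 x0 y) => //; last by rewrite x0x.
  - by move=> w /andP[x0w _]; rewrite mulr_ge0 ?(ltW mu0)// subr_ge0 zle.
  - by move=> s sT; exact: at0.
  - move=> s sT; apply: far => //; rewrite yE.
    by have -> : z x0 + q - z x0 = q by [ring]; rewrite qE; lra.
have [y yE] := onto (z x0 - q).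
have zx0x : z x <= z x0 by apply: zle; exact: ltW.
have absE : `|z x - z x0| = z x0 - z x by rewrite ler0_norm ?subr_le0// opprB.
have -> : - mu * `|z x - z x0| = - (- mu) * (z x - z x0) by rewrite absE; ring.
have -> : mu ^+ 2 = (- mu) ^+ 2 by rewrite sqrrN.
have dyE : - mu * (z y - z x0) = mu * q by rewrite yE; ring.
have [yx|xy] := leP y x; last first.
  have zyx : z x = z y.
    have : z x <= z y by apply: zle; exact: ltW.
    by move: q_ge; rewrite absE yE; lra.
  apply: far => //; last by rewrite sqrrN.
  by rewrite zyx dyE qE; lra.
apply: (@exp_barrier eta (- mu) t0 T x0 y x0) => //; last by rewrite yx ltW.
- by move=> w /andP[_ wx0]; rewrite mulNr -mulrN opprB mulr_ge0 ?(ltW mu0)// subr_ge0 zle.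
- move=> s sT; apply: far => //; last by rewrite sqrrN.
  by rewrite dyE qE; lra.
- by move=> s sT; exact: at0.
Qed.

Context (a1_gt0 : 0 < a1) (b_gt0 : 0 < b) (eta0_gt0 : 0 < eta0).

Let pi2_gt0 : 0 < pi / 2 :> R. Proof. by rewrite divr_gt0// pi_gt0. Qed.

Lemma initial_positivity (x0 : R) : continuous u0 -> 0 < u0 x0 ->
  exists2 eta1 : R, 0 < eta1 <= eta0 &
    forall t, 0 <= t <= 1 -> phi x0 * eta1 <= u t x0.
Proof.
move=> cu0 u0x0.
have [m [M [m0 M0 mM]]] := eigenfunction_bounds hl1 hl2 hphi.
have u00 : 0 < u0 x0 / 2 by rewrite divr_gt0.
have cx0 : u0 x @[x --> x0] --> u0 x0 by exact: cu0.
have [r /= r0 hr] := (cvgrPdist_lt _ _).1 cx0 _ u00.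
pose D := Num.min (z (x0 + r / 2) - z x0) (z x0 - z (x0 - r / 2)) / 2.
have [D0 D1 D2] : [/\ 0 < D, D < z (x0 + r / 2) - z x0
    & D < z x0 - z (x0 - r / 2)].
  have z1 : z x0 < z (x0 + r / 2) by apply: zinc; lra.
  have z2 : z (x0 - r / 2) < z x0 by apply: zinc; lra.
  rewrite /D; set D' := Num.min _ _.
  have D'0 : 0 < D' by rewrite lt_min !subr_gt0 z1.
  have D'1 : D' <= z (x0 + r / 2) - z x0 by rewrite ge_min lexx.
  have D'2 : D' <= z x0 - z (x0 - r / 2) by rewrite ge_min lexx orbT.
  by split; lra.
pose eta := Num.min eta0 (u0 x0 / 2 / M).
have eta_gt0 : 0 < eta by rewrite lt_min eta0_gt0 divr_gt0.
have eta_le : eta <= eta0 by rewrite ge_min lexx.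
have etaM : M * eta <= u0 x0 / 2.
  by rewrite mulrC -ler_pdivlMr// ge_min lexx orbT.
pose kappa := (pi / 2 / D) ^+ 2 * a1.
have kappa0 : 0 <= kappa by rewrite mulr_ge0 ?sqr_ge0// ltW.
have bump x : `|z x - z x0| <= D -> phi x * eta <= u 0 x.
  rewrite ler_norml => zx; have -> : u 0 x = u0 x by case: hu => _ _ ->.
  have xr : x0 - r / 2 < x < x0 + r / 2 by apply/andP; split; apply: zlt; lra.
  have ux : u0 x0 / 2 <= u0 x.
    have := hr x; rewrite /= ltr_norml => /(_ ltac:(lra)).
    by rewrite ltr_norml; lra.
  apply: le_trans ux; apply: le_trans etaM.
  by rewrite ler_pM2r//; case/andP: (mM x).
have kb : kappa <= b + kappa by rewrite lerDr ltW.
have eta01 : 0 <= eta <= eta0 by rewrite ltW.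
have dec := bump_barrier eta01 D0 kappa0 kb (ltW b_gt0) (lexx 0) bump.
exists (eta * expR (- kappa)).
  rewrite mulr_gt0 ?expR_gt0//= (le_trans _ eta_le)// ler_piMr ?(ltW eta_gt0)//.
  by rewrite -expR0 ler_expR oppr_le0.
move=> t t01; apply: le_trans (dec 1 t t01).
rewrite ler_pM2l// ler_pM2l// ler_expR subr0 mulNr lerN2 ler_piMr//; lra.
Qed.

(** The instability enters here: for [b > 0] a wide enough bump never decays.
    Spreading at a large speed provides such a bump at time 1. *)
Lemma lasting_positivity (eta1 x0 : R) : 0 < eta1 <= eta0 ->
  (forall t, 0 <= t <= 1 -> phi x0 * eta1 <= u t x0) ->
  exists2 eta2 : R, 0 < eta2 <= eta0 &
    forall t, 1 <= t -> phi x0 * eta2 <= u t x0.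
Proof.
move=> /andP[eta1_gt0 eta1_le] start.
pose eps := Num.sqrt (b / a1).
have eps0 : 0 < eps by rewrite sqrtr_gt0 divr_gt0.
pose D := pi / 2 / eps.
have D0 : 0 < D by rewrite divr_gt0.
have epsE : (pi / 2 / D) ^+ 2 * a1 <= b + 0.
  have -> : pi / 2 / D = eps by rewrite /D invf_div mulrCA divff ?mulr1// gt_eqF.
  rewrite sqr_sqrtr; last by rewrite divr_ge0// ltW.
  by rewrite divfK ?gt_eqF// addr0.
pose mu := D / a0 + 1.
have mu0 : 0 < mu by rewrite addr_gt0// divr_gt0.
have muE : mu * a0 = D + a0 by rewrite mulrDl divfK ?gt_eqF// mul1r.
pose e1 := expR (- mu * D); pose e2 := expR (- (mu ^+ 2 * a0) * (1 - 0)).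
have e12 : e2 < e1.
  rewrite ltr_expR subr0 mulr1 mulNr ltrN2 expr2 -mulrA muE ltr_pM2l//.
  by rewrite ltrDl.
have e1_le : e1 <= 1 by rewrite -expR0 ler_expR mulNr oppr_le0 mulr_ge0// ltW.
have e2_ge0 : 0 <= e2 by exact: expR_ge0.
pose eta2 := eta1 * (e1 - e2).
have eta2_gt0 : 0 < eta2 by rewrite mulr_gt0// subr_gt0.
have eta2_le : eta2 <= eta0.
  by apply: le_trans eta1_le; rewrite ler_piMr ?(ltW eta1_gt0)//; lra.
have eta1_01 : 0 <= eta1 <= eta0 by rewrite ltW.
have eta2_01 : 0 <= eta2 <= eta0 by rewrite ltW.
have bump x : `|z x - z x0| <= D -> phi x * eta2 <= u 1 x.
  move=> zx; have := spreading eta1_01 (ltW b_gt0) (lexx 0) mu0 start x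
    (ltac:(by rewrite lexx ler01) : 0 <= 1 <= 1).
  apply: le_trans; rewrite ler_pM2l// ler_pM2l// lerD2r ler_expR !mulNr lerN2.
  by rewrite ler_pM2l.
exists eta2; first by rewrite eta2_gt0.
move=> t t1; have t11 : 1 <= t <= t by rewrite t1 lexx.
have := bump_barrier eta2_01 D0 (lexx 0) epsE (ltW b_gt0) ler01 bump t11.
by rewrite oppr0 mul0r expR0 mulr1.
Qed.

(** As [t] tends to infinity and then [mu] to 0, the lower bound of the spreading
    lemma tends to [phi x * eta2] wherever [x] is; a small [mu] and a large [t],
    both depending on [x], give half of it. *)
Lemma uniform_positivity (eta2 x0 : R) : 0 < eta2 <= eta0 ->
  (forall t, 1 <= t -> phi x0 * eta2 <= u t x0) ->
  forall x, exists A : R, forall t, A <= t -> phi x * (eta2 / 2) <= u t x.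
Proof.
move=> /andP[eta2_gt0 eta2_le] far x; pose D := `|z x - z x0|.
have D0 : 0 <= D by exact: normr_ge0.
pose mu := (4 * (D + 1))^-1.
have D1 : 0 < 4 * (D + 1) by lra.
have mu0 : 0 < mu by rewrite invr_gt0.
have muD : mu * D <= 1 / 4 by rewrite mulrC ler_pdivrMr//; lra.
have c0 : 0 < mu ^+ 2 * a0 by rewrite mulr_gt0// exprn_gt0.
exists (1 + 3 / (mu ^+ 2 * a0)) => t tA.
have q0 : 0 < 3 / (mu ^+ 2 * a0) by rewrite divr_gt0.
have t1 : 1 <= t by lra.
have at0 s : 1 <= s <= t -> phi x0 * eta2 <= u s x0.
  by move=> /andP[s1 _]; exact: far.
have eta2_01 : 0 <= eta2 <= eta0 by rewrite ltW.
have := spreading eta2_01 (ltW b_gt0) ler01 mu0 at0 x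
  (ltac:(by rewrite t1 lexx) : 1 <= t <= t).
apply: le_trans; rewrite ler_pM2l// ler_pM2l//.
have e1 : 3 / 4 <= expR (- mu * `|z x - z x0|).
  by apply: le_trans (expR_ge1Dx _); rewrite mulNr -/D; lra.
have e2 : expR (- (mu ^+ 2 * a0) * (t - 1)) <= 1 / 4.
  have ge3 : 3 <= mu ^+ 2 * a0 * (t - 1).
    by rewrite mulrC -ler_pdivrMr//; lra.
  rewrite mulNr expRN div1r lef_pV2 ?posrE ?expR_gt0//.
  by apply: le_trans (expR_ge1Dx _); lra.
by lra.
Qed.

End Spreading.

(** * Persistence *)

Lemma limf_einf_ge {R : realType} (g : R -> R) (c A : R) :
  (forall t, A <= t -> c <= g t) ->
  (c%:E <= limf_einf (fun t => (g t)%:E) (pinfty_nbhs R))%E.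
Proof.
move=> gc; rewrite /limf_einf leeNr; apply: ge_ereal_inf.
exists (ereal_sup [set (- (g t)%:E)%E | t in [set t | A < t]]).
  exists [set t | A < t] => //; exists A; split=> //; exact: num_real.
apply: ub_ereal_sup => _ [t /= At <-].
by rewrite lee_fin lerN2; apply: gc; exact: ltW.
Qed.

Section Persistence.
Context {R : realType} (l1 l2 d1 d2 sigma : R) (f1 f2 : R -> R).
Context (hl1 : 0 < l1) (hl2 : 0 < l2) (hsigma : 0 < sigma).
Context (hd1 : 0 < d1) (hd2 : 0 < d2).
Context (f1C : is_C1 f1 /\ f1 0 = 0) (f2C : is_C1 f2 /\ f2 0 = 0).
Context (lambda : R) (phi : R -> R) (hneg : lambda < 0).
Context (hphi : principal_eigenfunction l1 l2 d1 d2 sigma f1 f2 lambda phi).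
Context (u0 : R -> R) (u : R -> R -> R).
Context (hu0_ge0 : forall x, 0 <= u0 x) (hu0_cont : continuous u0).
Context (hu0_neq0 : exists x, u0 x != 0).
Context (hu : patch_solution l1 l2 d1 d2 sigma f1 f2 u0 u).

Local Notation f := (fpatch f1 f2).
Let phi_pos x : 0 < phi x. Proof. exact: phi_gt0 hphi x. Qed.

(** Near zero [f s >= (f'(0) - beta) s] for any [beta > 0]; the choice
    [beta = - lambda / 2] leaves the other half of [- lambda] as a growth rate. *)
Lemma linear_growth : exists2 eta0 : R, 0 < eta0 &
  forall j x v, 0 <= v <= eta0 -> - lambda / 2 * (phi x * v) <=
    f j (phi x * v) - (derive1 (f j) 0 + lambda) * (phi x * v).
Proof.
have [m [M [m0 M0 mM]]] := eigenfunction_bounds hl1 hl2 hphi.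
have b0 : 0 < - lambda / 2 by have := hneg; lra.
have [s1 s10 h1] := linear_bound_right f1C.1 f1C.2 b0.
have [s2 s20 h2] := linear_bound_right f2C.1 f2C.2 b0.
exists (Num.min s1 s2 / M); first by rewrite divr_gt0// lt_min s10.
move=> j x v /andP[v0]; rewrite ler_pdivlMr// => vM.
have px := phi_pos x; have [_ xM] := andP (mM x).
have pv0 : 0 <= phi x * v by rewrite mulr_ge0// ltW.
have pvM : phi x * v <= Num.min s1 s2.
  by apply: le_trans vM; rewrite mulrC ler_wpM2l.
move: pvM; rewrite le_min => /andP[v1 v2].
have fj : (derive1 (f j) 0 - - lambda / 2) * (phi x * v) <= f j (phi x * v).
  by case: j; [apply: h1|apply: h2]; rewrite pv0.
by move: fj; lra.
Qed.

Lemma persistence : exists2 c : R, 0 < c &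
  forall x, exists A : R, forall t, A <= t -> c <= u t x.
Proof.
have [z hz] := phase_exists hl1 hl2 hsigma hphi.
have [a0 [a1 [a0_gt0 a1_gt0 ha]]] :=
  diffusion_bounds hl1 hl2 hsigma hd1 hd2 hphi.
have [eta0 eta0_gt0 hgrow] := linear_growth.
have u_ge0 := solution_ge0 hl1 hl2 hsigma hd1 hd2 f1C f2C hphi hz hu hu0_ge0.
have [m [M [m0 M0 mM]]] := eigenfunction_bounds hl1 hl2 hphi.
have b0 : 0 < - lambda / 2 by have := hneg; lra.
have [x0 ux0] := hu0_neq0.
have {}ux0 : 0 < u0 x0 by rewrite lt_neqAle eq_sym ux0 hu0_ge0.
have [eta1 eta1_gt0 step1] := initial_positivity hl1 hl2 hsigma hd1 hd2 f1C f2C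
  hphi hz hu u_ge0 ha hgrow a1_gt0 b0 eta0_gt0 hu0_cont ux0.
have [eta2 eta2_gt0 step2] := lasting_positivity hl1 hl2 hsigma hd1 hd2 f1C f2C
  hphi hz hu u_ge0 a0_gt0 ha hgrow a1_gt0 b0 eta1_gt0 step1.
have step3 := uniform_positivity hl1 hl2 hsigma hd1 hd2 f1C f2C
  hphi hz hu u_ge0 a0_gt0 ha hgrow b0 eta2_gt0 step2.
have {}eta2_gt0 : 0 < eta2 by case/andP: eta2_gt0.
exists (m * (eta2 / 2)); first by rewrite mulr_gt0// divr_gt0.
move=> x; have [A uA] := step3 x; exists A => t /uA; apply: le_trans.
by rewrite ler_pM2r ?divr_gt0//; case/andP: (mM x).
Qed.

End Persistence.

Theorem theorem2p1 (R : realType) (l1 l2 d1 d2 sigma : R) (f1 f2 : R -> R)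
    (K1 K2 theta : R)
    (hl1 : 0 < l1) (hl2 : 0 < l2) (hd1 : 0 < d1) (hd2 : 0 < d2)
    (hsigma : 0 < sigma) (hK1 : 0 < K1) (hK2 : 0 < K2)
    (htheta : 0 < theta < K2)
    (hf1 : KPP f1 K1) (hf2 : bistable f2 theta K2)
    (lambda1 : R)
    (hlambda1 : principal_eigenvalue l1 l2 d1 d2 sigma f1 f2 lambda1)
    (hneg : lambda1 < 0)
    (u0 : R -> R) (hu0_ge0 : forall x, 0 <= u0 x) (hu0_cont : continuous u0)
    (hu0_supp : compact (closure [set x | u0 x != 0]))
    (hu0_neq0 : exists x, u0 x != 0)
    (u : R -> R -> R)
    (hu : patch_solution l1 l2 d1 d2 sigma f1 f2 u0 u) :
  (0 < ereal_inf [set limf_einf (fun t => (u t x)%:E) (pinfty_nbhs R)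
                 | x in [set: R]])%E.
Proof.
have [phi hphi] := hlambda1.
have [c c0 uc] := persistence hl1 hl2 hsigma hd1 hd2 (KPP_C1 hf1)
  (bistable_C1 hf2) hneg hphi hu0_ge0 hu0_cont hu0_neq0 hu.
apply: (@lt_le_trans _ _ c%:E); first by rewrite lte_fin.
apply/ereal_infP => _ [x _ <-]; have [A uA] := uc x.
exact: limf_einf_ge uA.
Qed.
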